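(* For $\lambda\in P^+$, the $\mathfrak g\otimes A$-module $W_A(\lambda)$ is generated by $w_\lambda$ with defining relations $$(\mathfrak n^+\otimes A)w_\lambda=0,\qquad hw_\lambda=\lambda(h)w_\lambda,\qquad (x_i^-)^{\lambda(h_i)+1}w_\lambda=0,\qquad i\in I,\ h\in\mathfrak h.$$
   Context: $\mathfrak g$ is a finite-dimensional simple Lie algebra over $\mathbb C$ of rank $n$, $I=\{1,\dots,n\}$, $\mathfrak h$ a Cartan subalgebra, $R$ the root system, $\alpha_i,\omega_i$ ($i\in I$) the simple roots and fundamental weights, $Q^+$ and $P^+$ the $\mathbb Z_{\ge 0}$-spans of the $\alpha_i$ and of the $\omega_i$; $\mu\le\lambda$ iff $\lambda-\mu\in Q^+$. $x^\pm_\alpha$ ($\alpha\in R^+$), $h_i$ ($i\in I$) is a Chevalley basis, $x_i^\pm=x^\pm_{\alpha_i}$, $\mathfrak n^+=\bigoplus_{\alpha\in R^+}\mathbb C x^+_\alpha$. $\mathbf U(-)$ denotes universal enveloping algebra. $A$ is a commutative associative unital $\mathbb C$-algebra (containing $\mathbb C=\mathbb C\cdot1$); $\mathfrak g\otimes A$ is the Lie algebra with $[x\otimes a,y\otimes b]=[x,y]\otimes ab$, and $\mathfrak g$ is identified with $\mathfrak g\otimes 1$. $\mathcal I_A$ is the category of $\mathfrak g\otimes A$-modules that are locally finite-dimensional as $\mathfrak g$-modules (each element lies in a finite-dimensional $\mathfrak g$-submodule); $V_\mu$ denotes a weight space for $\mathfrak h$. For $\nu\in P^+$ and $V\in\mathcal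 I_A$, $V^\nu=V/\sum_{\mu\not\le\nu}\mathbf U(\mathfrak g\otimes A)V_\mu$ is the unique maximal $\mathfrak g\otimes A$-quotient of $V$ all of whose weights lie in $\nu-Q^+$. $V(\lambda)$ is the irreducible finite-dimensional $\mathfrak g$-module of highest weight $\lambda\in P^+$ with highest weight vector $v_\lambda$; $P_A(V(\lambda))=\mathbf U(\mathfrak g\otimes A)\otimes_{\mathbf U(\mathfrak g)}V(\lambda)\in\mathcal I_A$ and $p_\lambda=1\otimes v_\lambda$. Set $W_A(\lambda)=P_A(V(\lambda))^\lambda$ and let $w_\lambda$ be the image of $p_\lambda$. *)

(* Defs.v *)
From HB Require Import structures.
From mathcomp Require Import all_boot all_order all_algebra.
From mathcomp Require Import boolp.
From mathcomp Require Export reals complex.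

Set Implicit Arguments.
Unset Strict Implicit.
Unset Printing Implicit Defensive.

Import GRing.Theory.
Local Open Scope ring_scope.
Local Open Scope quotient_scope.

Section ClassicalQuotient.
Variables (T : Type) (r : T -> T -> Prop).
Hypotheses (r_refl : forall x, r x x) (r_sym : forall x y, r x y -> r y x)
  (r_trans : forall x y z, r x y -> r y z -> r x z).

Definition cq_rel : rel {classic T} := fun x y => `[< r x y >].

Lemma cq_rel_refl : reflexive cq_rel.
Proof. by move=> x; apply/asboolP/r_refl. Qed.

Lemma cq_rel_sym : symmetric cq_rel.
Proof. by move=> x y; apply/asboolP/asboolP => /r_sym. Qed.

Lemma cq_rel_trans : transitive cq_rel.
Proof. by move=> y x z /asboolP xy /asboolP yz; apply/asboolP/(r_trans xy). Qed.

Definition cq_equiv : equiv_rel {classic T} :=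
  EquivRel cq_rel cq_rel_refl cq_rel_sym cq_rel_trans.

Definition cquot := {eq_quot cq_equiv}.

HB.instance Definition _ := Choice.on cquot.

Definition cpi (x : T) : cquot := \pi_{eq_quot cq_equiv} (x : {classic T}).
Definition crepr (q : cquot) : T := repr (q : {eq_quot cq_equiv}).

Lemma cpi_eq (x y : T) : cpi x = cpi y <-> r x y.
Proof. by split=> [/eqmodP/asboolP | xy]; last exact/eqmodP/asboolP. Qed.

Lemma creprK (q : cquot) : cpi (crepr q) = q.
Proof. exact: reprK. Qed.

Lemma crepr_cpi (x : T) : r (crepr (cpi x)) x.
Proof. by apply/cpi_eq; rewrite creprK. Qed.

End ClassicalQuotient.

Section QuotientModule.
Variables (R : pzRingType) (V : lmodType R).
Implicit Type X : V -> Prop.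

Definition span_of X (v : V) : Prop :=
  exists2 s : seq (R * V), (forall p, p \in s -> X p.2)
    & v = \sum_(p <- s) p.1 *: p.2.

Lemma span_of0 X : span_of X 0.
Proof. by exists [::]; rewrite ?big_nil. Qed.

Lemma span_ofD X u v : span_of X u -> span_of X v -> span_of X (u + v).
Proof.
move=> [s Xs ->] [t Xt ->]; exists (s ++ t); last by rewrite big_cat.
by move=> p; rewrite mem_cat => /orP[/Xs|/Xt].
Qed.

Lemma span_ofZ X a u : span_of X u -> span_of X (a *: u).
Proof.
move=> [s Xs ->]; exists [seq (a * p.1, p.2) | p <- s].
  by move=> _ /mapP[p /Xs Xp ->].
by rewrite scaler_sumr big_map; apply: eq_bigr => p _ /=; rewrite scalerA.
Qed.

Lemma span_ofN X u : span_of X u -> span_of X (- u).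
Proof. by rewrite -scaleN1r; apply: span_ofZ. Qed.

Lemma span_of_gen X u : X u -> span_of X u.
Proof.
move=> Xu; exists [:: (1, u)]; last by rewrite big_seq1 scale1r.
by move=> p; rewrite inE => /eqP ->.
Qed.

Variable X : V -> Prop.

Definition modq_cong (u v : V) : Prop := span_of X (u - v).

Lemma modq_refl u : modq_cong u u.
Proof. by rewrite /modq_cong subrr; apply: span_of0. Qed.

Lemma modq_sym u v : modq_cong u v -> modq_cong v u.
Proof. by move/span_ofN; rewrite opprB. Qed.

Lemma modq_trans u v w : modq_cong u v -> modq_cong v w -> modq_cong u w.
Proof. by move=> uv /(span_ofD uv); rewrite addrA subrK. Qed.

Definition modq := cquot modq_refl modq_sym modq_trans.
HB.instance Definition _ := Choice.on modq.

Definition modq_pi (v : V) : modq := cpi modq_refl modq_sym modq_trans v.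
Definition modq_repr (q : modq) : V := crepr q.

Lemma modq_piP u v : modq_pi u = modq_pi v <-> span_of X (u - v).
Proof. exact: cpi_eq. Qed.

Lemma modq_reprK q : modq_pi (modq_repr q) = q.
Proof. exact: creprK. Qed.

Definition modq_zero : modq := modq_pi 0.
Definition modq_add (p q : modq) : modq := modq_pi (modq_repr p + modq_repr q).
Definition modq_opp (p : modq) : modq := modq_pi (- modq_repr p).
Definition modq_scale (a : R) (p : modq) : modq := modq_pi (a *: modq_repr p).

Lemma modq_addE u v : modq_add (modq_pi u) (modq_pi v) = modq_pi (u + v).
Proof.
apply/modq_piP; rewrite opprD addrACA.
by apply: span_ofD; apply/modq_piP/modq_reprK.
Qed.

Lemma modq_oppE u : modq_opp (modq_pi u) = modq_pi (- u).
Proof.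
by apply/modq_piP; rewrite -opprD; apply/span_ofN/modq_piP/modq_reprK.
Qed.

Lemma modq_scaleE a u : modq_scale a (modq_pi u) = modq_pi (a *: u).
Proof.
by apply/modq_piP; rewrite -scalerBr; apply/span_ofZ/modq_piP/modq_reprK.
Qed.

Lemma modq_ind (P : modq -> Prop) : (forall u, P (modq_pi u)) -> forall q, P q.
Proof. by move=> Ppi q; rewrite -(modq_reprK q). Qed.

Lemma modq_addA : associative modq_add.
Proof.
elim/modq_ind=> u; elim/modq_ind=> v; elim/modq_ind=> w.
by rewrite !modq_addE addrA.
Qed.

Lemma modq_addC : commutative modq_add.
Proof.
by elim/modq_ind=> u; elim/modq_ind=> v; rewrite !modq_addE addrC.
Qed.

Lemma modq_add0 : left_id modq_zero modq_add.
Proof. by elim/modq_ind=> u; rewrite modq_addE add0r. Qed.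

Lemma modq_addN : left_inverse modq_zero modq_opp modq_add.
Proof. by elim/modq_ind=> u; rewrite modq_oppE modq_addE addNr. Qed.

HB.instance Definition _ :=
  GRing.isZmodule.Build modq modq_addA modq_addC modq_add0 modq_addN.

Lemma modq_scaleA a b q : modq_scale a (modq_scale b q) = modq_scale (a * b) q.
Proof. by elim/modq_ind: q => u; rewrite !modq_scaleE scalerA. Qed.

Lemma modq_scale1 : left_id 1 modq_scale.
Proof. by elim/modq_ind=> u; rewrite modq_scaleE scale1r. Qed.

Lemma modq_scaleDr : right_distributive modq_scale +%R.
Proof.
move=> a; elim/modq_ind=> u; elim/modq_ind=> v.
rewrite [X in modq_scale a X]modq_addE !modq_scaleE [RHS]modq_addE.
by rewrite scalerDr.
Qed.

Lemma modq_scaleDl q : {morph modq_scale^~ q : a b / a + b}.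
Proof.
by elim/modq_ind: q => u a b; rewrite !modq_scaleE [RHS]modq_addE scalerDl.
Qed.

HB.instance Definition _ := GRing.Zmodule_isLmodule.Build R modq
  modq_scaleA modq_scale1 modq_scaleDr modq_scaleDl.

Lemma modq_pi_is_linear : linear modq_pi.
Proof. by move=> a u v; rewrite -modq_addE -modq_scaleE. Qed.

HB.instance Definition _ :=
  GRing.isLinear.Build R V modq *:%R modq_pi modq_pi_is_linear.

End QuotientModule.

(* [btens ra la] is the abelian group [M (x)_S N], where [S] acts on [M] on the
   right through [ra] and on [N] on the left through [la].  It is the set of
   formal sums of pure tensors, modulo the least congruence that makes the
   formal operations an abelian group structure and the pure tensors biadditive
   and balanced. *)
Section BalancedTensor.
Variables (M N : zmodType) (S : Type) (ra : M -> S -> M) (la : S -> N -> N).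

Inductive bterm : Type :=
| BPure of M & N
| BZero
| BOpp of bterm
| BAdd of bterm & bterm.

Inductive bcong : bterm -> bterm -> Prop :=
| bc_refl t : bcong t t
| bc_sym t u : bcong t u -> bcong u t
| bc_trans t u v : bcong t u -> bcong u v -> bcong t v
| bc_opp t t' : bcong t t' -> bcong (BOpp t) (BOpp t')
| bc_add t t' u u' : bcong t t' -> bcong u u' -> bcong (BAdd t u) (BAdd t' u')
| bc_addA t u v : bcong (BAdd t (BAdd u v)) (BAdd (BAdd t u) v)
| bc_addC t u : bcong (BAdd t u) (BAdd u t)
| bc_add0 t : bcong (BAdd BZero t) t
| bc_addN t : bcong (BAdd (BOpp t) t) BZero
| bc_pureDl m m' n : bcong (BPure (m + m') n) (BAdd (BPure m n) (BPure m' n))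
| bc_pureDr m n n' : bcong (BPure m (n + n')) (BAdd (BPure m n) (BPure m n'))
| bc_balanced m s n : bcong (BPure (ra m s) n) (BPure m (la s n)).

Definition btens := cquot bc_refl bc_sym bc_trans.
HB.instance Definition _ := Choice.on btens.

Definition bclass (t : bterm) : btens := cpi bc_refl bc_sym bc_trans t.

Definition bpure (m : M) (n : N) : btens := bclass (BPure m n).

Definition btens_zero : btens := bclass BZero.
Definition btens_opp (p : btens) : btens := bclass (BOpp (crepr p)).
Definition btens_add (p q : btens) : btens :=
  bclass (BAdd (crepr p) (crepr q)).

Lemma bclassP t u : bclass t = bclass u <-> bcong t u.
Proof. exact: cpi_eq. Qed.

Lemma btens_oppE t : btens_opp (bclass t) = bclass (BOpp t).
Proof. by apply/bclassP/bc_opp; apply: crepr_cpi. Qed.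

Lemma btens_addE t u : btens_add (bclass t) (bclass u) = bclass (BAdd t u).
Proof. by apply/bclassP/bc_add; apply: crepr_cpi. Qed.

Lemma bclass_ind (P : btens -> Prop) : (forall t, P (bclass t)) -> forall p, P p.
Proof. by move=> Pt p; rewrite -(creprK p). Qed.

Lemma btens_addA : associative btens_add.
Proof.
elim/bclass_ind=> t; elim/bclass_ind=> u; elim/bclass_ind=> v.
by rewrite !btens_addE; apply/bclassP/bc_addA.
Qed.

Lemma btens_addC : commutative btens_add.
Proof.
elim/bclass_ind=> t; elim/bclass_ind=> u.
by rewrite !btens_addE; apply/bclassP/bc_addC.
Qed.

Lemma btens_add0 : left_id btens_zero btens_add.
Proof. by elim/bclass_ind=> t; rewrite btens_addE; apply/bclassP/bc_add0. Qed.

Lemma btens_addN : left_inverse btens_zero btens_opp btens_add.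
Proof.
by elim/bclass_ind=> t; rewrite btens_oppE btens_addE; apply/bclassP/bc_addN.
Qed.

HB.instance Definition _ :=
  GRing.isZmodule.Build btens btens_addA btens_addC btens_add0 btens_addN.

Lemma bpureDl m m' n : bpure (m + m') n = bpure m n + bpure m' n.
Proof. by rewrite [RHS]btens_addE; apply/bclassP/bc_pureDl. Qed.

Lemma bpureDr m n n' : bpure m (n + n') = bpure m n + bpure m n'.
Proof. by rewrite [RHS]btens_addE; apply/bclassP/bc_pureDr. Qed.

Lemma bpure_balanced m s n : bpure (ra m s) n = bpure m (la s n).
Proof. exact/bclassP/bc_balanced. Qed.

Lemma btens_ind (P : btens -> Prop) :
    (forall m n, P (bpure m n)) -> P 0 -> (forall p, P p -> P (- p)) ->
    (forall p q, P p -> P q -> P (p + q)) ->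
  forall p, P p.
Proof.
move=> Ppure P0 PN PD; elim/bclass_ind.
elim=> [m n||t Pt|t Pt u Pu]; first exact: Ppure.
- exact: P0.
- by rewrite -btens_oppE; apply: PN.
- by rewrite -btens_addE; apply: PD.
Qed.

Section Lift.
Variables (W : zmodType) (f : M -> N -> W).

Fixpoint beval (t : bterm) : W :=
  match t with
  | BPure m n => f m n
  | BZero => 0
  | BOpp t => - beval t
  | BAdd t u => beval t + beval u
  end.

Definition btens_lift (p : btens) : W := beval (crepr p).

Hypotheses (fDl : forall m m' n, f (m + m') n = f m n + f m' n)
  (fDr : forall m n n', f m (n + n') = f m n + f m n')
  (f_balanced : forall m s n, f (ra m s) n = f m (la s n)).

Lemma beval_cong t u : bcong t u -> beval t = beval u.
Proof.
elim=> //= {t u}.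
- by move=> t u v _ -> _ ->.
- by move=> t u _ ->.
- by move=> t t' u u' _ -> _ ->.
- by move=> t u v; rewrite addrA.
- by move=> t u; rewrite addrC.
- by move=> t; rewrite add0r.
- by move=> t; rewrite addNr.
Qed.

Lemma btens_lift_class t : btens_lift (bclass t) = beval t.
Proof. by apply: beval_cong; apply: crepr_cpi. Qed.

Lemma btens_lift_pure m n : btens_lift (bpure m n) = f m n.
Proof. exact: btens_lift_class. Qed.

Lemma btens_liftD p q : btens_lift (p + q) = btens_lift p + btens_lift q.
Proof.
elim/bclass_ind: p => t; elim/bclass_ind: q => u.
by rewrite [_ + _ in LHS]btens_addE !btens_lift_class.
Qed.

Lemma btens_lift0 : btens_lift 0 = 0.
Proof. exact: btens_lift_class. Qed.

Lemma btens_liftN p : btens_lift (- p) = - btens_lift p.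
Proof. by apply/eqP; rewrite -addr_eq0 -btens_liftD addNr btens_lift0. Qed.

End Lift.

End BalancedTensor.

Section ExtensionOfScalars.
Variables (S B : pzRingType) (phi : {rmorphism S -> B}) (N : lmodType S).

Definition extscal : Type :=
  btens (fun (b : B) (s : S) => b * phi s) (fun (s : S) (n : N) => s *: n).

HB.instance Definition _ := GRing.Zmodule.on extscal.

Definition ext_pure (b : B) (n : N) : extscal := bpure _ _ b n.

Definition ext_scale (b : B) : extscal -> extscal :=
  btens_lift (fun b' n => ext_pure (b * b') n).

Lemma ext_scale_pure b b' n : ext_scale b (ext_pure b' n) = ext_pure (b * b') n.
Proof.
apply: btens_lift_pure => [m m' p|m p p'|m s p].
- by rewrite mulrDr [LHS]bpureDl.
- by rewrite [LHS]bpureDr.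
- by rewrite mulrA [LHS]bpure_balanced.
Qed.

Lemma ext_scaleDr : right_distributive ext_scale +%R.
Proof.
move=> b p q; apply: btens_liftD => [m m' n|m n n'|m s n].
- by rewrite mulrDr [LHS]bpureDl.
- by rewrite [LHS]bpureDr.
- by rewrite mulrA [LHS]bpure_balanced.
Qed.

Lemma ext_scale0 b : ext_scale b 0 = 0.
Proof. by apply: (addrI (ext_scale b 0)); rewrite -ext_scaleDr !addr0. Qed.

Lemma ext_scaleN b p : ext_scale b (- p) = - ext_scale b p.
Proof. by apply/eqP; rewrite -addr_eq0 -ext_scaleDr addNr ext_scale0. Qed.

Lemma ext_scaleA a b p : ext_scale a (ext_scale b p) = ext_scale (a * b) p.
Proof.
elim/btens_ind: p => [m n||p IHp|p q IHp IHq].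
- by rewrite -[bpure _ _ _ _]/(ext_pure m n) !ext_scale_pure mulrA.
- by rewrite !ext_scale0.
- by rewrite !ext_scaleN IHp.
- by rewrite !ext_scaleDr IHp IHq.
Qed.

Lemma ext_scale1 : left_id 1 ext_scale.
Proof.
elim/btens_ind=> [m n||p IHp|p q IHp IHq].
- by rewrite [LHS]ext_scale_pure mul1r.
- by rewrite ext_scale0.
- by rewrite ext_scaleN IHp.
- by rewrite ext_scaleDr IHp IHq.
Qed.

Lemma ext_scaleDl p : {morph ext_scale^~ p : a b / a + b}.
Proof.
move=> a b; elim/btens_ind: p => [m n||p IHp|p q IHp IHq].
- by rewrite -[bpure _ _ _ _]/(ext_pure m n) !ext_scale_pure mulrDl [LHS]bpureDl.
- by rewrite !ext_scale0 addr0.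
- by rewrite !ext_scaleN IHp opprD.
- by rewrite !ext_scaleDr IHp IHq addrACA.
Qed.

HB.instance Definition _ := GRing.Zmodule_isLmodule.Build B extscal
  ext_scaleA ext_scale1 ext_scaleDr ext_scaleDl.

End ExtensionOfScalars.

Section TensorProduct.
Variables (K : fieldType) (M N : lmodType K).

Definition tens : Type :=
  btens (fun (m : M) (k : K) => k *: m) (fun (k : K) (n : N) => k *: n).

HB.instance Definition _ := GRing.Zmodule.on tens.

Definition tpure (m : M) (n : N) : tens := bpure _ _ m n.

Lemma tpureDl m m' n : tpure (m + m') n = tpure m n + tpure m' n.
Proof. exact: bpureDl. Qed.

Lemma tpureDr m n n' : tpure m (n + n') = tpure m n + tpure m n'.
Proof. exact: bpureDr. Qed.

Lemma tpure_balanced k m n : tpure (k *: m) n = tpure m (k *: n).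
Proof. exact: bpure_balanced. Qed.

Definition tens_scale (k : K) : tens -> tens :=
  btens_lift (fun m n => tpure (k *: m) n).

Lemma tens_scale_pure k m n : tens_scale k (tpure m n) = tpure (k *: m) n.
Proof.
apply: btens_lift_pure => [? ? ?|? ? ?|? s ?].
- by rewrite scalerDr tpureDl.
- by rewrite tpureDr.
- by rewrite scalerA mulrC -scalerA tpure_balanced.
Qed.

Lemma tens_scaleDr : right_distributive tens_scale +%R.
Proof.
move=> k p q; apply: btens_liftD => [? ? ?|? ? ?|? s ?].
- by rewrite scalerDr tpureDl.
- by rewrite tpureDr.
- by rewrite scalerA mulrC -scalerA tpure_balanced.
Qed.

Lemma tens_scale0 k : tens_scale k 0 = 0.
Proof. by apply: (addrI (tens_scale k 0)); rewrite -tens_scaleDr !addr0. Qed.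

Lemma tens_scaleN k p : tens_scale k (- p) = - tens_scale k p.
Proof. by apply/eqP; rewrite -addr_eq0 -tens_scaleDr addNr tens_scale0. Qed.

Lemma tens_scaleA a b p : tens_scale a (tens_scale b p) = tens_scale (a * b) p.
Proof.
elim/btens_ind: p => [m n||p IHp|p q IHp IHq].
- by rewrite -[bpure _ _ _ _]/(tpure m n) !tens_scale_pure scalerA.
- by rewrite !tens_scale0.
- by rewrite !tens_scaleN IHp.
- by rewrite !tens_scaleDr IHp IHq.
Qed.

Lemma tens_scale1 : left_id 1 tens_scale.
Proof.
elim/btens_ind=> [m n||p IHp|p q IHp IHq].
- by rewrite [LHS]tens_scale_pure scale1r.
- by rewrite tens_scale0.
- by rewrite tens_scaleN IHp.
- by rewrite tens_scaleDr IHp IHq.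
Qed.

Lemma tens_scaleDl p : {morph tens_scale^~ p : a b / a + b}.
Proof.
move=> a b; elim/btens_ind: p => [m n||p IHp|p q IHp IHq].
- by rewrite -[bpure _ _ _ _]/(tpure m n) !tens_scale_pure scalerDl tpureDl.
- by rewrite !tens_scale0 addr0.
- by rewrite !tens_scaleN IHp opprD.
- by rewrite !tens_scaleDr IHp IHq addrACA.
Qed.

HB.instance Definition _ := GRing.Zmodule_isLmodule.Build K tens
  tens_scaleA tens_scale1 tens_scaleDr tens_scaleDl.

Lemma tpureZl k m n : tpure (k *: m) n = k *: tpure m n.
Proof. exact/esym/tens_scale_pure. Qed.

Lemma tpureZr k m n : tpure m (k *: n) = k *: tpure m n.
Proof. by rewrite -tpure_balanced tpureZl. Qed.

Lemma tens_ind (P : tens -> Prop) :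
    (forall m n, P (tpure m n)) -> (forall p q, P p -> P q -> P (p + q)) ->
  forall p, P p.
Proof.
move=> Ppure PD p.
suff: P p /\ P (- p) by case.
have P0 : P 0 by rewrite -[0](scale0r (tpure 0 0)) -tpureZl.
elim/btens_ind: p => [m n|||].
- by split; [exact: Ppure | rewrite -scaleN1r -[bpure _ _ _ _]/(tpure m n) -tpureZl].
- by rewrite oppr0.
- by move=> p [? ?]; rewrite opprK.
- by move=> p q [? ?] [? ?]; rewrite opprD; split; apply: PD.
Qed.

Section Lift.
Variables (W : lmodType K) (f : M -> N -> W).

Definition tens_lift : tens -> W := btens_lift f.

Hypotheses (fl : forall n k m m', f (k *: m + m') n = k *: f m n + f m' n)
  (fr : forall m k n n', f m (k *: n + n') = k *: f m n + f m n').

Let fDl m m' n : f (m + m') n = f m n + f m' n.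
Proof. by rewrite -[m]scale1r fl !scale1r. Qed.

Let fDr m n n' : f m (n + n') = f m n + f m n'.
Proof. by rewrite -[n]scale1r fr !scale1r. Qed.

Let fZl k m n : f (k *: m) n = k *: f m n.
Proof.
have f0 : f 0 n = 0 by apply: (addrI (f 0 n)); rewrite -fDl !addr0.
by rewrite -[k *: m]addr0 fl f0 addr0.
Qed.

Let fZr k m n : f m (k *: n) = k *: f m n.
Proof.
have f0 : f m 0 = 0 by apply: (addrI (f m 0)); rewrite -fDr !addr0.
by rewrite -[k *: n]addr0 fr f0 addr0.
Qed.

Let f_balanced m k n : f (k *: m) n = f m (k *: n).
Proof. by rewrite fZl fZr. Qed.

Lemma tens_lift_pure m n : tens_lift (tpure m n) = f m n.
Proof. exact: btens_lift_pure. Qed.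

Lemma tens_liftD p q : tens_lift (p + q) = tens_lift p + tens_lift q.
Proof. exact: btens_liftD. Qed.

Lemma tens_liftZ k p : tens_lift (k *: p) = k *: tens_lift p.
Proof.
elim/tens_ind: p => [m n|p q IHp IHq].
  by rewrite -tpureZl !tens_lift_pure fZl.
by rewrite scalerDr !tens_liftD IHp IHq scalerDr.
Qed.

Lemma tens_lift_is_linear : linear tens_lift.
Proof. by move=> k p q; rewrite tens_liftD tens_liftZ. Qed.

End Lift.

End TensorProduct.

HB.mixin Record Lmodule_isLie (K : fieldType) L of GRing.Lmodule K L := {
  lie : L -> L -> L;
  lie_linearl : forall z, linear (lie ^~ z);
  lie_linearr : forall x, linear (lie x);
  liexx : forall x, lie x x = 0;
  lie_jacobi : forall x y z,
    lie x (lie y z) + lie y (lie z x) + lie z (lie x y) = 0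
}.

#[short(type="lieType")]
HB.structure Definition Lie (K : fieldType) :=
  {L of GRing.Lmodule K L & Lmodule_isLie K L}.

#[short(type="finLieType")]
HB.structure Definition FinLie (K : fieldType) :=
  {L of Vector K L & Lie K L}.

Section LieTheory.
Variables (K : fieldType) (L : lieType K).
Implicit Types x y z : L.

Lemma lieDl x y z : lie (x + y) z = lie x z + lie y z.
Proof. by rewrite -[x]scale1r lie_linearl !scale1r. Qed.

Lemma lieDr x y z : lie x (y + z) = lie x y + lie x z.
Proof. by rewrite -[y]scale1r lie_linearr !scale1r. Qed.

Lemma lie_antisym x y : lie x y = - lie y x.
Proof.
apply/eqP; rewrite -addr_eq0; apply/eqP.
have := liexx (x + y); rewrite lieDl !lieDr !liexx add0r addr0.
by rewrite addrC.
Qed.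

End LieTheory.

Section CurrentAlgebra.
Variables (K : fieldType) (g : lieType K) (A : comAlgType K).

Definition current : Type := tens g A.

HB.instance Definition _ := GRing.Lmodule.on current.

Definition cpure (x : g) (a : A) : current := tpure x a.

Definition clie_pure (x : g) (a : A) : current -> current :=
  tens_lift (fun y b => cpure (lie x y) (a * b)).

Definition clie (p q : current) : current :=
  tens_lift (fun x a => clie_pure x a q) p.

Let clie_purel x a n k m m' :
  cpure (lie x (k *: m + m')) (a * n)
  = k *: cpure (lie x m) (a * n) + cpure (lie x m') (a * n).
Proof. by rewrite lie_linearr /cpure tpureDl tpureZl. Qed.

Let clie_purer x a m k n n' :
  cpure (lie x m) (a * (k *: n + n'))
  = k *: cpure (lie x m) (a * n) + cpure (lie x m) (a * n').
Proof. by rewrite mulrDr -scalerAr /cpure tpureDr tpureZr. Qed.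

Lemma clie_pureE x a y b :
  clie_pure x a (cpure y b) = cpure (lie x y) (a * b).
Proof.
exact: (tens_lift_pure (@clie_purel x a) (@clie_purer x a)).
Qed.

Lemma clie_pure_is_linear x a : linear (clie_pure x a).
Proof.
exact: (tens_lift_is_linear (@clie_purel x a) (@clie_purer x a)).
Qed.

Let clie_pureD x a p q : clie_pure x a (p + q) = clie_pure x a p + clie_pure x a q.
Proof. by rewrite -[p]scale1r clie_pure_is_linear !scale1r. Qed.

Let cliel q a k x x' :
  clie_pure (k *: x + x') a q = k *: clie_pure x a q + clie_pure x' a q.
Proof.
elim/tens_ind: q => [y b|p q IHp IHq].
  by rewrite ![clie_pure _ _ _]clie_pureE lie_linearl /cpure tpureDl tpureZl.
by rewrite !clie_pureD IHp IHq scalerDr addrACA.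
Qed.

Let clier q x k a a' :
  clie_pure x (k *: a + a') q = k *: clie_pure x a q + clie_pure x a' q.
Proof.
elim/tens_ind: q => [y b|p q IHp IHq].
  by rewrite ![clie_pure _ _ _]clie_pureE mulrDl -scalerAl /cpure tpureDr tpureZr.
by rewrite !clie_pureD IHp IHq scalerDr addrACA.
Qed.

Lemma clie_linearl q : linear (clie ^~ q).
Proof. exact: (tens_lift_is_linear (cliel q) (clier q)). Qed.

Lemma cliepE x a q : clie (cpure x a) q = clie_pure x a q.
Proof. exact: (tens_lift_pure (cliel q) (clier q)). Qed.

Lemma clieE x a y b :
  clie (cpure x a) (cpure y b) = cpure (lie x y) (a * b).
Proof. by rewrite cliepE clie_pureE. Qed.

Let clieDl p q r : clie (p + q) r = clie p r + clie q r.
Proof. by rewrite -[p]scale1r clie_linearl !scale1r. Qed.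

Lemma clie_linearr p : linear (clie p).
Proof.
move=> k q r; elim/tens_ind: p => [x a|p p' IHp IHp'].
  by rewrite ![clie (tpure _ _) _]cliepE clie_pure_is_linear.
by rewrite !clieDl IHp IHp' scalerDr addrACA.
Qed.

Let clieDr p q r : clie p (q + r) = clie p q + clie p r.
Proof. by rewrite -[q]scale1r clie_linearr !scale1r. Qed.

Let clie_antisym p q : clie p q + clie q p = 0.
Proof.
elim/tens_ind: p => [x a|p p' IHp IHp']; last first.
  by rewrite clieDl clieDr addrACA IHp IHp' addr0.
elim/tens_ind: q => [y b|q q' IHq IHq']; last first.
  by rewrite clieDl clieDr addrACA IHq IHq' addr0.
rewrite ![clie _ _]clieE [b * a]mulrC -[_ + _]tpureDl.
by rewrite [lie x y]lie_antisym addNr -[0](scale0r (0 : g)) tpureZl scale0r.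
Qed.

Lemma clie_xx p : clie p p = 0.
Proof.
elim/tens_ind: p => [x a|p q IHp IHq].
  by rewrite [LHS]clieE liexx -[0](scale0r (0 : g)) [LHS]tpureZl scale0r.
by rewrite clieDl !clieDr IHp IHq add0r addr0 clie_antisym.
Qed.

Lemma clie_jacobi p q r :
  clie p (clie q r) + clie q (clie r p) + clie r (clie p q) = 0.
Proof.
have add3 (a b c a' b' c' : current) :
    a + a' + (b + b') + (c + c') = a + b + c + (a' + b' + c').
  by rewrite (addrACA a a') (addrACA (a + b)).
elim/tens_ind: p => [x a|p p' IHp IHp']; last first.
  by rewrite !(clieDl, clieDr) add3 IHp IHp' addr0.
elim/tens_ind: q => [y b|q q' IHq IHq']; last first.
  by rewrite !(clieDl, clieDr) add3 IHq IHq' addr0.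
elim/tens_ind: r => [z c|r r' IHr IHr']; last first.
  by rewrite !(clieDl, clieDr) add3 IHr IHr' addr0.
rewrite -!/(cpure _ _) !clieE.
have -> : b * (c * a) = a * (b * c) by rewrite mulrA mulrC.
have -> : c * (a * b) = a * (b * c) by rewrite mulrC -mulrA.
rewrite -!tpureDl lie_jacobi.
by rewrite -[0](scale0r (0 : g)) tpureZl scale0r.
Qed.

HB.instance Definition _ := Lmodule_isLie.Build K current
  clie_linearl clie_linearr clie_xx clie_jacobi.

End CurrentAlgebra.

(* The unital associative algebra generated by the vector space [L] with the
   relations [xy - yx = [x, y]]: formal polynomial expressions in the elements
   of [L], modulo the least congruence that makes the formal operations a
   [K]-algebra structure (the scalars being the constants), [UGen] linear, and
   [UGen [x, y]] the commutator of [UGen x] and [UGen y]. *)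
Section EnvelopingAlgebra.
Variables (K : fieldType) (L : lieType K).

Inductive uterm : Type :=
| UConst of K
| UGen of L
| UAdd of uterm & uterm
| UMul of uterm & uterm.

Inductive ucong : uterm -> uterm -> Prop :=
| uc_refl t : ucong t t
| uc_sym t u : ucong t u -> ucong u t
| uc_trans t u v : ucong t u -> ucong u v -> ucong t v
| uc_add t t' u u' : ucong t t' -> ucong u u' -> ucong (UAdd t u) (UAdd t' u')
| uc_mul t t' u u' : ucong t t' -> ucong u u' -> ucong (UMul t u) (UMul t' u')
| uc_addA t u v : ucong (UAdd t (UAdd u v)) (UAdd (UAdd t u) v)
| uc_addC t u : ucong (UAdd t u) (UAdd u t)
| uc_add0 t : ucong (UAdd (UConst 0) t) t
| uc_addN t : ucong (UAdd (UMul (UConst (- 1)) t) t) (UConst 0)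
| uc_mulA t u v : ucong (UMul t (UMul u v)) (UMul (UMul t u) v)
| uc_mul1 t : ucong (UMul (UConst 1) t) t
| uc_mulDl t u v : ucong (UMul (UAdd t u) v) (UAdd (UMul t v) (UMul u v))
| uc_mulDr t u v : ucong (UMul t (UAdd u v)) (UAdd (UMul t u) (UMul t v))
| uc_constD a b : ucong (UConst (a + b)) (UAdd (UConst a) (UConst b))
| uc_constM a b : ucong (UConst (a * b)) (UMul (UConst a) (UConst b))
| uc_constC a t : ucong (UMul (UConst a) t) (UMul t (UConst a))
| uc_genD x y : ucong (UGen (x + y)) (UAdd (UGen x) (UGen y))
| uc_genZ a x : ucong (UGen (a *: x)) (UMul (UConst a) (UGen x))
| uc_lie x y : ucong (UAdd (UGen (lie x y)) (UMul (UGen y) (UGen x)))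
                     (UMul (UGen x) (UGen y)).

Definition uenv := cquot uc_refl uc_sym uc_trans.
HB.instance Definition _ := Choice.on uenv.

Definition uclass (t : uterm) : uenv := cpi uc_refl uc_sym uc_trans t.

Definition ugen (x : L) : uenv := uclass (UGen x).

Definition uconst (a : K) : uenv := uclass (UConst a).
Definition uadd (p q : uenv) : uenv := uclass (UAdd (crepr p) (crepr q)).
Definition umul (p q : uenv) : uenv := uclass (UMul (crepr p) (crepr q)).
Definition uopp (p : uenv) : uenv := umul (uconst (- 1)) p.
Definition uscale (a : K) (p : uenv) : uenv := umul (uconst a) p.

Lemma uclassP t u : uclass t = uclass u <-> ucong t u.
Proof. exact: cpi_eq. Qed.

Lemma uclass_ind (P : uenv -> Prop) : (forall t, P (uclass t)) -> forall p, P p.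
Proof. by move=> Pt p; rewrite -(creprK p). Qed.

Lemma uaddE t u : uadd (uclass t) (uclass u) = uclass (UAdd t u).
Proof. by apply/uclassP/uc_add; apply: crepr_cpi. Qed.

Lemma umulE t u : umul (uclass t) (uclass u) = uclass (UMul t u).
Proof. by apply/uclassP/uc_mul; apply: crepr_cpi. Qed.

Lemma uaddA : associative uadd.
Proof.
elim/uclass_ind=> t; elim/uclass_ind=> u; elim/uclass_ind=> v.
by rewrite !uaddE; apply/uclassP/uc_addA.
Qed.

Lemma uaddC : commutative uadd.
Proof.
elim/uclass_ind=> t; elim/uclass_ind=> u.
by rewrite !uaddE; apply/uclassP/uc_addC.
Qed.

Lemma uadd0 : left_id (uconst 0) uadd.
Proof. by elim/uclass_ind=> t; rewrite uaddE; apply/uclassP/uc_add0. Qed.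

Lemma uaddN : left_inverse (uconst 0) uopp uadd.
Proof.
by elim/uclass_ind=> t; rewrite /uopp umulE uaddE; apply/uclassP/uc_addN.
Qed.

HB.instance Definition _ := GRing.isZmodule.Build uenv uaddA uaddC uadd0 uaddN.

Lemma umulA : associative umul.
Proof.
elim/uclass_ind=> t; elim/uclass_ind=> u; elim/uclass_ind=> v.
by rewrite !umulE; apply/uclassP/uc_mulA.
Qed.

Lemma uconstC a p : umul (uconst a) p = umul p (uconst a).
Proof.
by elim/uclass_ind: p => t; rewrite !umulE; apply/uclassP/uc_constC.
Qed.

Lemma umul1 : left_id (uconst 1) umul.
Proof. by elim/uclass_ind=> t; rewrite umulE; apply/uclassP/uc_mul1. Qed.

Lemma umulr1 : right_id (uconst 1) umul.
Proof. by move=> p; rewrite -uconstC umul1. Qed.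

Lemma umulDl : left_distributive umul uadd.
Proof.
elim/uclass_ind=> t; elim/uclass_ind=> u; elim/uclass_ind=> v.
by rewrite !(umulE, uaddE); apply/uclassP/uc_mulDl.
Qed.

Lemma umulDr : right_distributive umul uadd.
Proof.
elim/uclass_ind=> t; elim/uclass_ind=> u; elim/uclass_ind=> v.
by rewrite !(umulE, uaddE); apply/uclassP/uc_mulDr.
Qed.

Section Eval.
Variables (B : algType K) (f : L -> B).

Fixpoint ueval (t : uterm) : B :=
  match t with
  | UConst a => a%:A
  | UGen x => f x
  | UAdd t u => ueval t + ueval u
  | UMul t u => ueval t * ueval u
  end.

Definition uenv_lift (p : uenv) : B := ueval (crepr p).

Hypotheses (f_linear : linear f)
  (f_lie : forall x y, f (lie x y) = f x * f y - f y * f x).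

Lemma ueval_cong t u : ucong t u -> ueval t = ueval u.
Proof.
have fD x y : f (x + y) = f x + f y by rewrite -[x]scale1r f_linear !scale1r.
have f0 : f 0 = 0 by apply: (addrI (f 0)); rewrite -fD !addr0.
have fZ a x : f (a *: x) = a *: f x by rewrite -[a *: x]addr0 f_linear f0 addr0.
elim=> //= {t u}.
- by move=> t u v _ -> _ ->.
- by move=> t t' u u' _ -> _ ->.
- by move=> t t' u u' _ -> _ ->.
- by move=> t u v; rewrite addrA.
- by move=> t u; rewrite addrC.
- by move=> t; rewrite scale0r add0r.
- by move=> t; rewrite mulr_algl scaleN1r addNr scale0r.
- by move=> t u v; rewrite mulrA.
- by move=> t; rewrite scale1r mul1r.
- by move=> t u v; rewrite mulrDl.
- by move=> t u v; rewrite mulrDr.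
- by move=> a b; rewrite scalerDl.
- by move=> a b; rewrite mulr_algl scalerA.
- by move=> a t; rewrite mulr_algl mulr_algr.
- by move=> a x; rewrite mulr_algl fZ.
- by move=> x y; rewrite f_lie subrK.
Qed.

Lemma uenv_lift_class t : uenv_lift (uclass t) = ueval t.
Proof. by apply: ueval_cong; apply: crepr_cpi. Qed.

End Eval.

Lemma uconst1_neq0 : uconst 1 != uconst 0.
Proof.
apply/eqP => eq10; pose f (_ : L) : K^o := 0.
have lf : linear f by move=> a x y; rewrite /f scaler0 addr0.
have Lf x y : f (lie x y) = f x * f y - f y * f x by rewrite /f mulr0 subrr.
have := congr1 (uenv_lift f) eq10; rewrite !(uenv_lift_class lf Lf) /= scale0r.
by rewrite scale1r => /eqP; rewrite oner_eq0.
Qed.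

HB.instance Definition _ := GRing.Zmodule_isNzRing.Build uenv
  umulA umul1 umulr1 umulDl umulDr uconst1_neq0.

Lemma uconstD a b : uconst (a + b) = uconst a + uconst b.
Proof. by rewrite [RHS]uaddE; apply/uclassP/uc_constD. Qed.

Lemma uconstM a b : uconst (a * b) = uconst a * uconst b.
Proof. by rewrite [RHS]umulE; apply/uclassP/uc_constM. Qed.

Lemma uscaleA a b p : uscale a (uscale b p) = uscale (a * b) p.
Proof. by rewrite /uscale umulA uconstM. Qed.

Lemma uscale1 : left_id 1 uscale.
Proof. exact: umul1. Qed.

Lemma uscaleDr : right_distributive uscale +%R.
Proof. by move=> a; apply: umulDr. Qed.

Lemma uscaleDl p : {morph uscale^~ p : a b / a + b}.
Proof. by move=> a b; rewrite /uscale uconstD [LHS]umulDl. Qed.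

HB.instance Definition _ := GRing.Zmodule_isLmodule.Build K uenv
  uscaleA uscale1 uscaleDr uscaleDl.

Lemma uscaleAl a (p q : uenv) : a *: (p * q) = (a *: p) * q.
Proof. exact: umulA. Qed.

HB.instance Definition _ := GRing.Lmodule_isLalgebra.Build K uenv uscaleAl.

Lemma uscaleAr a (p q : uenv) : a *: (p * q) = p * (a *: q).
Proof. by rewrite [LHS]umulA uconstC [RHS]umulA. Qed.

HB.instance Definition _ := GRing.Lalgebra_isAlgebra.Build K uenv uscaleAr.

Lemma uconstE a : uconst a = a%:A.
Proof. by rewrite -[LHS]umulr1. Qed.

Lemma ugen_is_linear : linear ugen.
Proof.
move=> a x y.
have -> : ugen (a *: x + y) = ugen (a *: x) + ugen y.
  by rewrite [RHS]uaddE; apply/uclassP/uc_genD.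
by congr (_ + _); rewrite [RHS]umulE; apply/uclassP/uc_genZ.
Qed.

HB.instance Definition _ :=
  GRing.isLinear.Build K L uenv *:%R ugen ugen_is_linear.

Lemma ugen_lie x y : ugen (lie x y) = ugen x * ugen y - ugen y * ugen x.
Proof.
apply/eqP; rewrite eq_sym subr_eq; apply/eqP.
rewrite [LHS]umulE [_ * _ in RHS]umulE [RHS]uaddE.
exact/uclassP/uc_sym/uc_lie.
Qed.

Lemma uenv_ind (P : uenv -> Prop) :
    (forall a, P a%:A) -> (forall x, P (ugen x)) ->
    (forall p q, P p -> P q -> P (p + q)) ->
    (forall p q, P p -> P q -> P (p * q)) ->
  forall p, P p.
Proof.
move=> Pc Pg PD PM; elim/uclass_ind; elim=> [a|x|t Pt u Pu|t Pt u Pu].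
- by rewrite -[uclass _]/(uconst a) uconstE.
- exact: Pg.
- by rewrite -uaddE; apply: PD.
- by rewrite -umulE; apply: PM.
Qed.

Section LiftMorphism.
Variables (B : algType K) (f : L -> B).
Hypotheses (f_linear : linear f)
  (f_lie : forall x y, f (lie x y) = f x * f y - f y * f x).

Let liftE := uenv_lift_class f_linear f_lie.

Lemma uenv_lift_gen x : uenv_lift f (ugen x) = f x.
Proof. exact: liftE. Qed.

Lemma uenv_liftC a : uenv_lift f a%:A = a%:A.
Proof. by rewrite -uconstE liftE. Qed.

Lemma uenv_liftD : {morph uenv_lift f : p q / p + q}.
Proof.
elim/uclass_ind=> t; elim/uclass_ind=> u.
by rewrite [_ + _ in LHS]uaddE !liftE.
Qed.

Lemma uenv_lift_is_zmod_morphism : zmod_morphism (uenv_lift f).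
Proof.
move=> p q; apply/eqP; rewrite eq_sym subr_eq; apply/eqP.
by rewrite -uenv_liftD subrK.
Qed.

Lemma uenv_lift_is_monoid_morphism : monoid_morphism (uenv_lift f).
Proof.
split=> [|p q]; first by rewrite -[1]scale1r uenv_liftC scale1r.
elim/uclass_ind: p => t; elim/uclass_ind: q => u.
by rewrite [_ * _ in LHS]umulE !liftE.
Qed.

End LiftMorphism.

End EnvelopingAlgebra.

Section EnvelopingInclusion.
Variables (K : fieldType) (g : lieType K) (A : comAlgType K).

Definition gen1 (x : g) : uenv (current g A) := ugen (cpure x 1).

Lemma gen1_is_linear : linear gen1.
Proof. by move=> a x y; rewrite -linearP /gen1 /cpure tpureDl tpureZl. Qed.

Lemma gen1_lie x y : gen1 (lie x y) = gen1 x * gen1 y - gen1 y * gen1 x.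
Proof. by rewrite -ugen_lie /gen1 [lie (cpure _ _) _]clieE mulr1. Qed.

Definition uinc : uenv g -> uenv (current g A) := uenv_lift gen1.

HB.instance Definition _ := GRing.isZmodMorphism.Build _ _ uinc
  (uenv_lift_is_zmod_morphism gen1_is_linear gen1_lie).
HB.instance Definition _ := GRing.isMonoidMorphism.Build _ _ uinc
  (uenv_lift_is_monoid_morphism gen1_is_linear gen1_lie).

End EnvelopingInclusion.

Section SimpleLieAlgebra.
Variables (K : fieldType) (g : finLieType K).
Implicit Types U V H I : {vspace g}.

Definition lie_ideal I : Prop := forall x y, y \in I -> lie x y \in I.

Definition simple_lie : Prop :=
  (exists x y : g, lie x y != 0)
  /\ (forall I, lie_ideal I -> I = 0%VS \/ I = fullv).

(* Brackets of basis vectors span [[U, V]], by bilinearity. *)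
Definition lie_prod U V : {vspace g} :=
  <<[seq lie x y | x <- vbasis U, y <- vbasis V]>>%VS.

Definition lower_central U (k : nat) : {vspace g} := iter k (lie_prod U) U.

Definition cartan_subalgebra H : Prop :=
  [/\ forall x y, x \in H -> y \in H -> lie x y \in H,
      exists k, lower_central H k = 0%VS
    & forall x, (forall y, y \in H -> lie x y \in H) -> x \in H].

End SimpleLieAlgebra.

Section Roots.
Variables (K : fieldType) (g : finLieType K) (H : {vspace g}).

Definition hdual : Type := 'Hom(subvs_of H, K^o).
HB.instance Definition _ := Vector.on hdual.

Definition heval (mu : hdual) (t : subvs_of H) : K :=
  (mu : 'Hom(subvs_of H, K^o)) t.

Definition root_space (mu : hdual) (y : g) : Prop :=
  forall t : subvs_of H, lie (vsval t) y = heval mu t *: y.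

Definition root_system (rts : seq hdual) : Prop :=
  uniq rts
  /\ (forall mu, mu \in rts <-> mu != 0 /\ exists2 y, y != 0 & root_space mu y).

Variable (n : nat).
Implicit Types (alpha omega : 'I_n -> hdual).

Definition nat_span alpha (mu : hdual) : Prop :=
  exists c : 'I_n -> nat, mu = \sum_i alpha i *+ c i.

Definition weight_le alpha (mu nu : hdual) : Prop := nat_span alpha (nu - mu).

Definition simple_roots (rts : seq hdual) alpha : Prop :=
  [/\ basis_of fullv [seq alpha i | i <- enum 'I_n],
      forall i, alpha i \in rts
    & forall mu, mu \in rts -> nat_span alpha mu \/ nat_span alpha (- mu)].

Definition positive_roots (rts : seq hdual) alpha : seq hdual :=
  [seq mu <- rts | `[< nat_span alpha mu >]].

(* [x mu] is the root vector of the root [mu], so that [x^+_beta = x beta] and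
   [x^-_beta = x (- beta)] for [beta] positive; values of [x] outside [rts] are
   irrelevant.  [co mu] is the coroot [h_mu], that is, the element of
   [[g_mu, g_{- mu}]] on which [mu] takes the value 2. *)
Definition chevalley_basis (rts : seq hdual) alpha (x : hdual -> g)
    (h : 'I_n -> subvs_of H) : Prop :=
  [/\ forall mu, mu \in rts -> root_space mu (x mu),
      basis_of fullv ([seq x mu | mu <- rts] ++ [seq vsval (h i) | i <- enum 'I_n]),
      exists co : hdual -> subvs_of H,
        (forall mu, mu \in rts ->
           lie (x mu) (x (- mu)) = vsval (co mu) /\ heval mu (co mu) = 2)
        /\ (forall i, h i = co (alpha i))
    & forall mu nu, mu \in rts -> nu \in rts -> mu + nu \in rts ->
        exists2 c : K, lie (x mu) (x nu) = c *: x (mu + nu)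
          & lie (x (- mu)) (x (- nu)) = - c *: x (- (mu + nu))].

Definition fundamental_weights (h : 'I_n -> subvs_of H) omega : Prop :=
  forall i j, heval (omega i) (h j) = (i == j)%:R.

Definition nplus (rts : seq hdual) alpha (x : hdual -> g) : {vspace g} :=
  <<[seq x mu | mu <- positive_roots rts alpha]>>%VS.

(* [U] is [U(g)] or [U(g (x) A)], and [iota] is the map of [g] into it. *)
Definition weight_space (U : algType K) (iota : g -> U) (M : lmodType U)
    (mu : hdual) (m : M) : Prop :=
  forall t : subvs_of H, iota (vsval t) *: m = (heval mu t)%:A *: m.

End Roots.

Section Modules.
Variables (K : fieldType) (U : algType K) (M : lmodType U).

Definition findim_module : Prop :=
  exists s : seq M, forall m, exists c : 'I_(size s) -> K,
    m = \sum_i (c i)%:A *: s`_i.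

Definition irreducible_module : Prop :=
  (exists m : M, m != 0)
  /\ (forall N : M -> Prop,
        N 0 -> (forall u m m', N m -> N m' -> N (u *: m + m')) ->
        (forall m, N m -> m = 0) \/ (forall m, N m)).

(* Over [U^o], the left regular module, [span_of] is the generated left ideal:
   [m] generates [M], and its annihilator is the left ideal generated by [rel]. *)
Definition presented_by (m : M) (rel : U -> Prop) : Prop :=
  (forall m', exists u, m' = u *: m)
  /\ (forall u : U, u *: m = 0 <-> span_of (rel : U^o -> Prop) u).

End Modules.

Section WeylModules.
Variables (K : fieldType) (g : finLieType K) (H : {vspace g}) (n : nat).
Variables (rts : seq (hdual H)) (alpha : 'I_n -> hdual H).
Variables (x : hdual H -> g) (h : 'I_n -> subvs_of H).

Definition highest_weight_vector (lam : hdual H) (V : lmodType (uenv g)) (v : V) :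
    Prop :=
  [/\ v != 0, weight_space (@ugen K g) lam v
    & forall y, y \in nplus rts alpha x -> ugen y *: v = 0].

Variable A : comAlgType K.
Notation UA := (uenv (current g A)).

Definition bad_weight_vector (nu : hdual H) (M : lmodType UA) (m : M) : Prop :=
  exists2 mu, ~ weight_le alpha mu nu & weight_space (@gen1 K g A) mu m.

(* [M^nu], the quotient of [M] by the sum of the [U(g (x) A) M_mu] over all
   weights [mu] with [not (mu <= nu)] *)
Definition truncation (nu : hdual H) (M : lmodType UA) : lmodType UA :=
  modq (@bad_weight_vector nu M).

Definition PA (V : lmodType (uenv g)) : lmodType UA := extscal (@uinc K g A) V.

Definition p_ (V : lmodType (uenv g)) (v : V) : PA V :=
  ext_pure (@uinc K g A) 1 v.

Definition WA (lam : hdual H) (V : lmodType (uenv g)) : lmodType UA :=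
  truncation lam (PA V).

Definition w_ (lam : hdual H) (V : lmodType (uenv g)) (v : V) : WA lam V :=
  modq_pi (@bad_weight_vector lam (PA V)) (p_ v).

(* [weyl_relation lam u] says that [u w = 0] is one of the defining relations; in
   the last one [k] is the natural number [lam(h_i)]. *)
Inductive weyl_relation (lam : hdual H) : UA -> Prop :=
| weyl_nplus y a :
    y \in nplus rts alpha x -> weyl_relation lam (ugen (cpure y a))
| weyl_cartan t :
    weyl_relation lam (gen1 A (vsval t) - (heval lam t)%:A)
| weyl_power i k :
    heval lam (h i) = k%:R ->
    weyl_relation lam (gen1 A (x (- alpha i)) ^+ k.+1).

End WeylModules.

(* Main.v *)
From HB Require Import structures.
Require Import Defs.
From mathcomp Require Import all_boot all_order all_algebra.
From mathcomp Require Import boolp reals complex.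
From mathcomp Require Import ring.

(** Write w for the image of p in W = W_A(lam), J for the left ideal of
    U(g (x) A) generated by the relations, M for U(g (x) A) / J and m for the
    class of 1 in M.

    The relations hold in W.  If b is a positive root then (x_b (x) a) p has
    weight lam + b, which is not below lam, so it dies in the truncation
    ([weyl_relation_w]); the Cartan and power relations already hold for the
    highest weight vector v of the finite-dimensional module V
    ([highest_weight_power]).

    Conversely, a map W -> M sending w to m shows that the annihilator of w is
    contained in J.  By the universal properties of the truncation and of the
    induced module, it comes from a g-linear map V -> M sending v to m as soon
    as the weights of M are at most lam.  The weights are controlled by the
    easy half of the Poincare-Birkhoff-Witt theorem: M is spanned by the images
    of m under products of elements of (n^- + h) (x) A ([lower_span_op],
    [weyl_quotient_weights]).

    The map V -> M is where the representation theory of g enters.  Its graph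
    has to be the g-submodule D of V x M generated by (v, m), and D is a graph
    exactly when it meets 0 x M trivially.  Now D is generated by a highest
    weight vector on which every x^-_i is nilpotent, and such a module is
    simple ([integrable_simple]); its submodule of pairs (0, u) does not
    contain (v, m), hence is zero ([graph_functional], [highest_weight_lift]).

    Simplicity is proved with the Casimir operator, which acts on D by a
    scalar depending on lam only.  A nonzero submodule contains a nonzero
    weight vector killed by n^+, of some weight mu <= lam; mu is dominant by sl2
    theory, and comparison of the two Casimir scalars gives, for
    beta = lam - mu, the equation (lam + mu + 2 rho, beta) = 0, a sum of
    nonnegative terms which forces beta = 0 ([casimir_value_inj]).  So the
    submodule contains a vector of weight lam, that is, the generator.

    The positivity used here is obtained from the Chevalley basis.  The numbers
    beta(h_alpha) are real by sl2 theory in the adjoint representation, so the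
    Killing form satisfies (h_alpha, h_alpha) > 0; this gives explicit dual
    bases for the Casimir operator.  The inequality 2 rho(h_i) > 0 holds because
    h_i is a commutator, so it has trace zero on the sum of the root spaces
    of the positive roots that are not multiples of alpha_i
    ([coroot_trace], [sum_positive_coroot_gt0]). *)

Set Implicit Arguments.
Unset Strict Implicit.
Unset Printing Implicit Defensive.

Import Order.TTheory GRing.Theory Num.Theory.
Local Open Scope ring_scope.

(** * Representations of a Lie algebra *)
Section LieRep.
Variables (K : fieldType) (g : lieType K).

(** The action is a bare function rather than a module over the enveloping
    algebra, so that the adjoint representation, products and restrictions of
    modules over U(g) or U(g (x) A) are all instances without any transport. *)
Record lie_rep (V : lmodType K) (act : g -> V -> V) : Prop := LieRep {
  rep_linl : forall v, linear (act^~ v);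
  rep_linr : forall y, linear (act y);
  rep_lie : forall y z v, act (lie y z) v = act y (act z v) - act z (act y v)
}.

Section Theory.
Variables (V : lmodType K) (act : g -> V -> V).
Hypothesis rV : lie_rep act.

Lemma rep_swap y z v : act y (act z v) = act z (act y v) + act (lie y z) v.
Proof. by rewrite (rep_lie rV) addrC subrK. Qed.

Lemma repDr y : {morph act y : u v / u + v}.
Proof. by move=> u v; rewrite -[u]scale1r (rep_linr rV) !scale1r. Qed.

Lemma rep0r y : act y 0 = 0.
Proof. by apply: (addrI (act y 0)); rewrite -repDr !addr0. Qed.

Lemma repZr y a u : act y (a *: u) = a *: act y u.
Proof. by rewrite -[a *: u]addr0 (rep_linr rV) rep0r addr0. Qed.

Lemma repNr y : {morph act y : u / - u}.
Proof. by move=> u; rewrite -scaleN1r repZr scaleN1r. Qed.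

Lemma repDl v : {morph act^~ v : y z / y + z}.
Proof. by move=> y z /=; rewrite -[y]scale1r (rep_linl rV) !scale1r. Qed.

Lemma rep0l v : act 0 v = 0.
Proof. by apply: (addrI (act 0 v)); rewrite -(repDl v) !addr0. Qed.

Lemma repZl a y v : act (a *: y) v = a *: act y v.
Proof. by rewrite -[a *: y]addr0 (rep_linl rV) rep0l addr0. Qed.

Lemma rep_sumr y I (s : seq I) P (F : I -> V) :
  act y (\sum_(i <- s | P i) F i) = \sum_(i <- s | P i) act y (F i).
Proof. exact: (big_morph (act y) (repDr y) (rep0r y)). Qed.

Lemma rep_suml v I (s : seq I) P (F : I -> g) :
  act (\sum_(i <- s | P i) F i) v = \sum_(i <- s | P i) act (F i) v.
Proof. exact: (big_morph (act^~ v) (repDl v) (rep0l v)). Qed.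

End Theory.

Lemma adjoint_rep : lie_rep (fun y z : g => lie y z).
Proof.
split=> [z|y|y z v]; [exact: lie_linearl|exact: lie_linearr|].
have lieNr a b : lie a (- b) = - lie a b.
  apply/eqP; rewrite -addr_eq0 -lieDr addNr; apply/eqP.
  by apply: (addrI (lie a 0)); rewrite -lieDr !addr0.
rewrite lie_antisym [lie y v]lie_antisym lieNr opprK.
by apply/eqP; rewrite eq_sym -addr_eq0 lie_jacobi.
Qed.

End LieRep.

(** * Representations of sl2 *)

Section Sl2.
Variables (K : numFieldType) (g : lieType K).
Variables (V : lmodType K) (act : g -> V -> V).
Hypothesis rV : lie_rep act.

(** The Leibniz rule: f^q (y v) is a combination of the (ad f)^j (y) f^(q-j) v, and
    all of them vanish once q is the sum of the two nilpotency exponents.  The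
    induction is on that sum, peeling off one f at a time, which avoids the
    binomial coefficients. *)
Lemma nilpotent_act f y v :
  (exists j, iter j (lie f) y = 0) -> (exists p, iter p (act f) v = 0) ->
  exists q, iter q (act f) (act y v) = 0.
Proof.
move=> [j yj] [p vp].
have iter_add q u w : iter q (act f) (u + w) = iter q (act f) u + iter q (act f) w.
  by elim: q => //= q ->; rewrite (repDr rV).
have iter0 q : iter q (act f) 0 = 0 by elim: q => //= q ->; rewrite (rep0r rV).
exists (j + p)%N; move en : (j + p)%N => n.
elim: n j p y v en yj vp => [|n IHn] j p y v.
  by move/eqP; rewrite addn_eq0 => /andP[/eqP-> _] /= -> _; rewrite (rep0l rV).
move=> en yj vp; rewrite iterSr (rep_swap rV) iter_add.
case: p vp en => [/= -> _|p vp en].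
  by rewrite !(rep0r rV) iter0 addr0.
rewrite iterSr in vp; case: j yj en => [/= -> _|j yj en].
  rewrite (rep0l rV) iter0 add0r (rep0r (adjoint_rep g)) (rep0l rV).
  exact: iter0.
rewrite iterSr in yj; rewrite (IHn j.+1 p) ?add0r; first 1 last.
- by move: en; rewrite addnS => -[].
- by rewrite iterSr.
- by [].
apply: (IHn j p.+1) => //; last by rewrite iterSr.
by move: en; rewrite addSn => -[].
Qed.

Variables e f hh : g.
Hypotheses (ef : lie e f = hh) (hf : lie hh f = (- 2) *: f)
  (he : lie hh e = 2 *: e).

Lemma sl2_weight_raise m v c : act hh v = c *: v ->
  act hh (iter m (act e) v) = (c + 2 * m%:R) *: iter m (act e) v.
Proof.
move=> hv; elim: m => [|m IHm] /=; first by rewrite mulr0 addr0.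
rewrite (rep_swap rV) IHm he (repZr rV) (repZl rV) -scalerDl.
by congr (_ *: _); rewrite -natr1; ring.
Qed.

Lemma sl2_weight_lower m v c : act hh v = c *: v ->
  act hh (iter m (act f) v) = (c - 2 * m%:R) *: iter m (act f) v.
Proof.
move=> hv; elim: m => [|m IHm] /=; first by rewrite mulr0 subr0.
rewrite (rep_swap rV) IHm hf (repZr rV) (repZl rV) -scalerDl.
by congr (_ *: _); rewrite -natr1; ring.
Qed.

Lemma sl2_raise_lower m v c : act e v = 0 -> act hh v = c *: v ->
  act e (iter m.+1 (act f) v) = (m.+1%:R * (c - m%:R)) *: iter m (act f) v.
Proof.
move=> ev hv; elim: m => [|m IHm].
  by rewrite /= (rep_swap rV) ev (rep0r rV) ef hv add0r subr0 mul1r.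
rewrite iterS (rep_swap rV) IHm ef (repZr rV) (sl2_weight_lower _ hv) -scalerDl.
by congr (_ *: _); rewrite -!natr1; ring.
Qed.

(** If f^m v is the last nonzero vector of the string, then applying e to
    f^(m+1) v = 0 gives (m+1)(c - m) = 0. *)
Lemma sl2_dominant v c : v != 0 -> act e v = 0 -> act hh v = c *: v ->
  (exists q, iter q (act f) v = 0) ->
  exists k, c = k%:R /\ iter k.+1 (act f) v = 0.
Proof.
move=> v0 ev hv fv.
have /ex_minnP[[|m]] : exists q, iter q (act f) v == 0.
  by case: fv => q /eqP; exists q.
  by rewrite /= (negPf v0).
move=> /eqP fm0 min_m; exists m; split=> //.
have fm : iter m (act f) v != 0 by apply/negP => /min_m; rewrite ltnn.
have := sl2_raise_lower m ev hv; rewrite fm0 (rep0r rV) => /esym/eqP.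
by rewrite scaler_eq0 (negPf fm) orbF mulf_eq0 pnatr_eq0 subr_eq0 => /eqP.
Qed.

(** The last nonzero vector e^m v of the raising string is a highest weight
    vector, so c + 2m is a natural number.  Only the reality of c matters
    below, where squares of such numbers have to be nonnegative. *)
Lemma sl2_weight_real v c : v != 0 -> act hh v = c *: v ->
  (exists p, iter p (act e) v = 0) ->
  (forall u, exists q, iter q (act f) u = 0) -> c \is Num.real.
Proof.
move=> v0 hv ev f_nil.
have /ex_minnP[[|m]] : exists p, iter p (act e) v == 0.
  by case: ev => p /eqP; exists p.
  by rewrite /= (negPf v0).
move=> /eqP em0 min_m.
have em : iter m (act e) v != 0 by apply/negP => /min_m; rewrite ltnn.
have [k [ck _]] := sl2_dominant em em0 (sl2_weight_raise m hv) (f_nil _).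
rewrite -[c](addrK (2 * m%:R)) ck.
by rewrite rpredB // ?rpredM ?realn.
Qed.

End Sl2.

(** * Weight vectors *)

Section Weights.
Variables (K : fieldType) (g : finLieType K) (H : {vspace g}).
Implicit Types (mu nu : hdual H) (t : subvs_of H).

Lemma hevalD mu nu t : heval (mu + nu) t = heval mu t + heval nu t.
Proof. by rewrite /heval add_lfunE. Qed.

Lemma hevalN mu t : heval (- mu) t = - heval mu t.
Proof. by rewrite /heval opp_lfunE. Qed.

Lemma heval0 t : heval (0 : hdual H) t = 0.
Proof. by rewrite /heval zero_lfunE. Qed.

Lemma hevalB mu nu t : heval (mu - nu) t = heval mu t - heval nu t.
Proof. by rewrite hevalD hevalN. Qed.

Lemma hevalZ a mu t : heval (a *: mu) t = a * heval mu t.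
Proof. by rewrite /heval scale_lfunE. Qed.

Lemma hevalMn mu k t : heval (mu *+ k) t = heval mu t *+ k.
Proof. by elim: k => [|k IHk]; rewrite ?heval0 // !mulrS hevalD IHk. Qed.

Lemma heval_sum I (r : seq I) P (F : I -> hdual H) t :
  heval (\sum_(i <- r | P i) F i) t = \sum_(i <- r | P i) heval (F i) t.
Proof.
exact: (big_morph (fun mu => heval mu t) (fun mu nu => hevalD mu nu t) (heval0 t)).
Qed.

Lemma hevalZr mu a t : heval mu (a *: t) = a * heval mu t.
Proof. by rewrite /heval linearZ. Qed.

Lemma heval_sumr mu I (r : seq I) P (F : I -> subvs_of H) :
  heval mu (\sum_(i <- r | P i) F i) = \sum_(i <- r | P i) heval mu (F i).
Proof. by rewrite /heval linear_sum. Qed.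

Lemma heval_inj mu nu : (forall t, heval mu t = heval nu t) -> mu = nu.
Proof. by move=> mu_nu; apply/lfunP. Qed.

Lemma heval_neq mu nu : mu != nu -> exists t, heval mu t != heval nu t.
Proof.
move=> neq; apply: contrapT => no_t; case/eqP: neq; apply: heval_inj => t.
by apply/eqP; apply/negPn/negP => neq_t; apply: no_t; exists t.
Qed.

Variables (V : lmodType K) (act : g -> V -> V).

Definition hweight mu (v : V) := forall t, act (vsval t) v = heval mu t *: v.

(** The terms may repeat weights: sums are built by adding vectors in proofs by
    induction, and merging equal weights would only get in the way. *)
Definition weight_sum (X : hdual H -> Prop) (v : V) :=
  exists2 s : seq (hdual H * V),
    (forall p, p \in s -> X p.1 /\ hweight p.1 p.2) & v = \sum_(p <- s) p.2.

Hypothesis rV : lie_rep act.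

Lemma hweightD mu u v : hweight mu u -> hweight mu v -> hweight mu (u + v).
Proof. by move=> hu hv t; rewrite (repDr rV) hu hv scalerDr. Qed.

Lemma hweightZ mu a u : hweight mu u -> hweight mu (a *: u).
Proof. by move=> hu t; rewrite (repZr rV) hu !scalerA mulrC. Qed.

Lemma hweight_root mu nu y u : @root_space K g H mu y -> hweight nu u ->
  hweight (mu + nu) (act y u).
Proof.
move=> hy hu t; rewrite (rep_swap rV) hu hy (repZr rV) (repZl rV) -scalerDl.
by rewrite hevalD addrC.
Qed.

Lemma hweight_uniq mu nu u : u != 0 -> hweight mu u -> hweight nu u -> mu = nu.
Proof.
move=> u0 hmu hnu; apply: heval_inj => t; apply/eqP; rewrite -subr_eq0.
have : (heval mu t - heval nu t) *: u == 0 by rewrite scalerBl -hmu -hnu subrr.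
by rewrite scaler_eq0 (negPf u0) orbF.
Qed.

Lemma weight_sum_gen (X : hdual H -> Prop) mu u :
  X mu -> hweight mu u -> weight_sum X u.
Proof.
move=> Xmu hu; exists [:: (mu, u)]; last by rewrite big_seq1.
by move=> p; rewrite inE => /eqP ->.
Qed.

Lemma weight_sumD X u v : weight_sum X u -> weight_sum X v -> weight_sum X (u + v).
Proof.
move=> [s Xs ->] [s' Xs' ->]; exists (s ++ s'); last by rewrite big_cat.
by move=> p; rewrite mem_cat => /orP[/Xs|/Xs'].
Qed.

Lemma weight_sum0 X : weight_sum X 0.
Proof. by exists [::]; rewrite ?big_nil. Qed.

Lemma weight_sum_map (X Y : hdual H -> Prop) (f : hdual H -> hdual H) (F : V -> V) u :
  {morph F : x y / x + y} -> F 0 = 0 -> (forall mu, X mu -> Y (f mu)) ->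
  (forall mu v, X mu -> hweight mu v -> hweight (f mu) (F v)) ->
  weight_sum X u -> weight_sum Y (F u).
Proof.
move=> FD F0 XY hF [s Xs ->]; exists [seq (f p.1, F p.2) | p <- s].
  by move=> _ /mapP[p /Xs[Xp hp] ->] /=; split; [exact: XY | exact: hF].
by rewrite big_map; apply: (big_morph F).
Qed.

Lemma weight_sumZ X a u : weight_sum X u -> weight_sum X (a *: u).
Proof.
apply: (@weight_sum_map X X id) => //= [x y||mu v _].
- exact: scalerDr.
- exact: scaler0.
- exact: hweightZ.
Qed.

(** The usual Vandermonde argument, in the form of an induction on the number of
    terms: if u is not itself a vector of the first weight mu, then some
    t - mu(t) does not kill it, keeps it in P, and kills its first term. *)
Lemma weight_sum_component (P : V -> Prop) X u :
    (forall a v w, P v -> P w -> P (a *: v + w)) ->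
    (forall t v, P v -> P (act (vsval t) v)) ->
    P u -> u != 0 -> weight_sum X u ->
  exists2 mu, X mu & exists v, [/\ P v, v != 0 & hweight mu v].
Proof.
move=> Plin Pact Pu u0 [s Xs us]; move ek: (size s) => k.
elim: k s ek u Xs us Pu u0 => [|k IHk] [|[mu w] s] //= ek u Xs us Pu u0.
  by move: us u0; rewrite big_nil => ->; rewrite eqxx.
have [Xmu hw] := Xs _ (mem_head _ _).
have [hu|/existsNP[t ut]] := pselect (hweight mu u); first by exists mu => //; exists u.
pose F v := act (vsval t) v - heval mu t *: v.
have FD v v' : F (v + v') = F v + F v'.
  by rewrite /F (repDr rV) scalerDr opprD addrACA.
have F0 : F 0 = 0 by rewrite /F (rep0r rV) scaler0 subrr.
case: ek => sk; apply: (IHk [seq (p.1, F p.2) | p <- s] _ (F u)).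
- by rewrite size_map.
- move=> _ /mapP[p ps ->] /=; have [|Xp hp] := Xs p.
    by rewrite inE ps orbT.
  split=> // t'; rewrite /F hp -scalerBl.
  by rewrite (repZr rV) hp !scalerA mulrC.
- rewrite big_map /= us big_cons /= FD [F w]/F hw subrr add0r.
  exact: (big_morph F).
- by rewrite /F addrC -scaleNr; apply: Plin => //; exact: Pact.
- by rewrite subr_eq0; apply/eqP.
Qed.

(** Apply [weight_sum_component] to the space of all vectors of weight mu. *)
Lemma weight_sum_weight X mu u :
  u != 0 -> hweight mu u -> weight_sum X u -> X mu.
Proof.
move=> u0 hu Xu; have := @weight_sum_component (hweight mu) X u _ _ hu u0 Xu.
case=> [a v w hv hw|t v hv|nu Xnu [v [hv v0 hnu]]].
- by apply: hweightD => //; exact: hweightZ.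
- by rewrite hv; exact: hweightZ.
- by rewrite (hweight_uniq v0 hv hnu).
Qed.

End Weights.

(** * Consequences of a Chevalley basis *)

Section RootDatum.
Variables (K : numFieldType) (g : finLieType K) (H : {vspace g}) (n : nat).
Variables (rts : seq (hdual H)) (alpha omega : 'I_n -> hdual H).
Variables (x : hdual H -> g) (h : 'I_n -> subvs_of H) (co : hdual H -> subvs_of H).
Implicit Types (mu nu beta : hdual H) (t : subvs_of H) (i j : 'I_n).

(** A Chevalley basis with its coroots [co] made explicit, as they occur in most
    formulas below. *)
Record root_datum : Prop := RootDatum {
  rd_rank : \dim H = n;
  rd_roots : root_system rts;
  rd_simple : simple_roots rts alpha;
  rd_root_vector : forall mu, mu \in rts -> root_space mu (x mu);
  rd_basis : basis_of fullv ([seq x mu | mu <- rts] ++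
                             [seq vsval (h i) | i <- enum 'I_n]);
  rd_coroot : forall mu, mu \in rts -> lie (x mu) (x (- mu)) = vsval (co mu);
  rd_coroot2 : forall mu, mu \in rts -> heval mu (co mu) = 2;
  rd_simple_coroot : forall i, h i = co (alpha i);
  rd_bracket : forall mu nu, mu \in rts -> nu \in rts -> mu + nu \in rts ->
    exists c : K, lie (x mu) (x nu) = c *: x (mu + nu);
  rd_fundamental : fundamental_weights h omega
}.

Hypothesis RD : root_datum.

Lemma root_neq0 mu : mu \in rts -> mu != 0.
Proof. by case: (rd_roots RD) => _ rtsP /rtsP[]. Qed.

Lemma root_mem mu y : mu != 0 -> y != 0 -> root_space mu y -> mu \in rts.
Proof.
by move=> mu0 y0 hy; case: (rd_roots RD) => _ rtsP; apply/rtsP; split=> //; exists y.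
Qed.

Lemma simple_root_mem i : alpha i \in rts.
Proof. by case: (rd_simple RD). Qed.

Lemma root_basis_ind (P : g -> Prop) :
  (forall a y z, P y -> P z -> P (a *: y + z)) -> P 0 ->
  (forall mu, mu \in rts -> P (x mu)) -> (forall i, P (vsval (h i))) ->
  forall y, P y.
Proof.
move=> Plin P0 Px Ph y; pose X := [seq x mu | mu <- rts] ++ [seq vsval (h i) | i <- enum 'I_n].
have -> : y = \sum_(k < size X) coord (in_tuple X) k y *: X`_k.
  by apply: coord_span; rewrite (span_basis (rd_basis RD)) memvf.
elim/big_ind: _ => [//|u v Pu Pv|k _]; first by rewrite -[u]scale1r; exact: Plin.
rewrite -[_ *: _]addr0; apply: Plin => //.
have : X`_k \in X by apply: mem_nth.
by rewrite mem_cat => /orP[/mapP[mu /Px ? ->]|/mapP[i _ ->]].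
Qed.

Lemma root_vector_neq0 mu : mu \in rts -> x mu != 0.
Proof.
move=> mu_rt; apply: (basis_not0 (rd_basis RD)).
by rewrite mem_cat map_f.
Qed.

(** The h_i are n linearly independent elements of H, whose dimension is n; the
    fundamental weights read off the coordinates. *)
Lemma cartan_decomp t : t = \sum_i heval (omega i) t *: h i.
Proof.
pose hs := [tuple vsval (h i) | i < n].
have hsE : hs = [seq vsval (h i) | i <- enum 'I_n] :> seq g by [].
have bh : basis_of H hs.
  rewrite basisEfree size_tuple (rd_rank RD) leqnn andbT hsE.
  rewrite (catr_free (basis_free (rd_basis RD))) /=.
  by apply/span_subvP => _ /mapP[i _ ->]; exact: subvsP.
have [c tc] : exists c : 'I_n -> K, t = \sum_i c i *: h i.
  exists (fun i => coord hs i (vsval t)); apply: val_inj => /=.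
  rewrite linear_sum {1}(coord_basis bh (subvsP t)) /=.
  by apply: eq_bigr => i _; rewrite -hsE -tnth_nth tnth_mktuple.
rewrite {1}tc; apply: eq_bigr => i _; congr (_ *: _).
rewrite tc heval_sumr (bigD1 i) //= hevalZr (rd_fundamental RD) eqxx mulr1.
rewrite big1 ?addr0 // => j /negPf ji.
by rewrite hevalZr (rd_fundamental RD) eq_sym ji mulr0.
Qed.


Lemma fweight_decomp mu : mu = \sum_i heval mu (h i) *: omega i.
Proof.
apply: heval_inj => t; rewrite {1}(cartan_decomp t) heval_sumr heval_sum.
by apply: eq_bigr => i _; rewrite hevalZr hevalZ mulrC.
Qed.

Lemma lie_root_cartan mu t : mu \in rts ->
  lie (x mu) (vsval t) = - heval mu t *: x mu.
Proof. by move=> mu_rt; rewrite lie_antisym (rd_root_vector RD mu_rt) scaleNr. Qed.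

Lemma lie_root_root mu nu : mu \in rts -> nu \in rts -> mu + nu != 0 ->
  exists c : K, lie (x mu) (x nu) = c *: x (mu + nu)
    /\ (mu + nu \notin rts -> c = 0).
Proof.
move=> mu_rt nu_rt mn0; have [mn|mnN] := boolP (mu + nu \in rts).
  by have [c ->] := rd_bracket RD mu_rt nu_rt mn; exists c.
exists 0; split=> //; rewrite scale0r; apply/eqP; apply: contraNT mnN => y0.
rewrite addrC in mn0 *; apply: (root_mem mn0 y0).
rewrite addrC; apply: (hweight_root (adjoint_rep g)); exact: (rd_root_vector RD).
Qed.

(** If -mu were not a root then, whatever the vector x (- mu) is, its bracket with
    the root vector of mu would be a combination of root vectors: no basis
    vector of g has weight -mu.  But this bracket is the coroot, a nonzero
    element of H. *)
Lemma root_oppr mu : mu \in rts -> - mu \in rts.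
Proof.
move=> mu_rt; apply/negPn/negP => muN.
pose Xr := [seq x nu | nu <- rts]; pose Xh := [seq vsval (h i) | i <- enum 'I_n].
have := basis_free (rd_basis RD); rewrite cat_free => /and3P[_ _].
rewrite directv_addE => /and3P[_ _ /eqP cap0].
have : vsval (co mu) \in (<<Xr>> :&: <<Xh>>)%VS.
  rewrite memv_cap; apply/andP; split; last first.
    rewrite (cartan_decomp (co mu)) linear_sum; apply: rpred_sum => i _.
    rewrite linearZ rpredZ // memv_span //.
    by apply: map_f; rewrite mem_enum.
  rewrite -(rd_coroot RD mu_rt); elim/root_basis_ind: (x (- mu)).
  - by move=> a y z hy hz; rewrite lie_linearr rpredD // rpredZ.
  - by rewrite (rep0r (adjoint_rep g)) rpred0.
  - move=> nu nu_rt; have mn0 : mu + nu != 0.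
      by apply: contraNneq muN => /eqP; rewrite addrC addr_eq0 => /eqP <-.
    have [c [-> c0]] := lie_root_root mu_rt nu_rt mn0.
    have [mn|/c0 ->] := boolP (mu + nu \in rts); last by rewrite scale0r rpred0.
    by rewrite rpredZ // memv_span // map_f.
  - by move=> i; rewrite lie_root_cartan // rpredZ // memv_span // map_f.
rewrite cap0 memv0 => /eqP co0.
have {}co0 : co mu = 0 by apply: val_inj.
have := rd_coroot2 RD mu_rt; rewrite co0 -(scale0r 0) hevalZr mul0r => /esym/eqP.
by rewrite pnatr_eq0.
Qed.

(** H is abelian because it is spanned by the brackets of x_alpha and x_(-alpha),
    on which the two weights of t cancel. *)
Lemma cartan_weight0 t : root_space (0 : hdual H) (vsval t).
Proof.
rewrite (cartan_decomp t) linear_sum => t'; rewrite heval0 scale0r.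
rewrite (rep_sumr (adjoint_rep g)) big1 // => i _.
rewrite linearZ (repZr (adjoint_rep g)) (rd_simple_coroot RD) /=.
have ai := simple_root_mem i.
rewrite -(rd_coroot RD ai) (rep_swap (adjoint_rep g)).
rewrite (rd_root_vector RD (root_oppr ai)) (rd_root_vector RD ai).
rewrite (repZr (adjoint_rep g)) (repZl (adjoint_rep g)) -scalerDl hevalN addNr.
by rewrite scale0r scaler0.
Qed.


(** The basis of H dual to the simple roots; by [heval_coweight] its values on a
    weight are the coordinates of that weight on the simple roots. *)
Definition coweight j : subvs_of H :=
  \sum_k coord [tuple alpha i | i < n] j (omega k) *: h k.

Lemma heval_coweight mu j :
  heval mu (coweight j) = coord [tuple alpha i | i < n] j mu.
Proof.
rewrite {2}(fweight_decomp mu) linear_sum heval_sumr; apply: eq_bigr => k _.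
by rewrite hevalZr linearZ [RHS]mulrC.
Qed.

Let alpha_basis : basis_of fullv [tuple alpha i | i < n].
Proof. by case: (rd_simple RD). Qed.

Lemma coweight_alpha i j : heval (alpha i) (coweight j) = (i == j)%:R.
Proof.
rewrite heval_coweight.
have -> : alpha i = [tuple alpha i | i < n]`_i by rewrite -tnth_nth tnth_mktuple.
by rewrite coord_free ?(basis_free alpha_basis).
Qed.

Lemma simple_decomp mu : mu = \sum_i heval mu (coweight i) *: alpha i.
Proof.
rewrite {1}(coord_basis alpha_basis (memvf mu)); apply: eq_bigr => i _.
by rewrite heval_coweight -tnth_nth tnth_mktuple.
Qed.

Lemma coweight_decomp t : t = \sum_i heval (alpha i) t *: coweight i.
Proof.
rewrite [LHS]cartan_decomp [RHS]cartan_decomp; apply: eq_bigr => k _.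
congr (_ *: _); rewrite [omega k]simple_decomp heval_sum.
rewrite -simple_decomp heval_sumr; apply: eq_bigr => i _.
by rewrite hevalZ hevalZr mulrC.
Qed.

Lemma coweight_nat_span mu : nat_span alpha mu ->
  forall j, exists k : nat, heval mu (coweight j) = k%:R.
Proof.
move=> [c ->] j; exists (c j); rewrite heval_sum (bigD1 j) //= hevalMn.
rewrite coweight_alpha eqxx big1 ?addr0 // => i /negPf ij.
by rewrite hevalMn coweight_alpha ij mul0rn.
Qed.

Lemma nat_span_coweight mu :
  (forall j, exists k : nat, heval mu (coweight j) = k%:R) -> nat_span alpha mu.
Proof.
move=> /choice[c hc]; exists c; rewrite {1}[mu]simple_decomp.
by apply: eq_bigr => i _; rewrite hc scaler_nat.
Qed.

Lemma positive_rootP mu :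
  reflect (mu \in rts /\ nat_span alpha mu) (mu \in positive_roots rts alpha).
Proof.
by rewrite mem_filter; apply: (iffP andP) => [[/asboolP ? ?]|[? /asboolP ?]].
Qed.

Lemma simple_root_positive i : alpha i \in positive_roots rts alpha.
Proof.
apply/positive_rootP; split; first exact: simple_root_mem.
by apply: nat_span_coweight => j; exists (i == j); rewrite coweight_alpha.
Qed.

Lemma positive_rootVN mu : mu \in rts ->
  mu \in positive_roots rts alpha \/ - mu \in positive_roots rts alpha.
Proof.
move=> mu_rt; case: (rd_simple RD) => _ _ /(_ mu mu_rt)[pos|neg]; [left|right].
  by apply/positive_rootP.
by apply/positive_rootP; split=> //; exact: root_oppr.
Qed.

Lemma positive_rootN mu : mu \in positive_roots rts alpha ->
  - mu \notin positive_roots rts alpha.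
Proof.
move=> /positive_rootP[mu_rt /coweight_nat_span mu_pos]; apply/negP.
move=> /positive_rootP[_ /coweight_nat_span mu_neg].
have /eqP := root_neq0 mu_rt; apply; rewrite [mu]simple_decomp big1 // => i _.
have [[k hk] [l]] := (mu_pos i, mu_neg i); rewrite hevalN hk => /eqP.
rewrite -subr_eq0 -opprD oppr_eq0 -natrD pnatr_eq0 addn_eq0 => /andP[/eqP -> _].
by rewrite scale0r.
Qed.

End RootDatum.

(** * Sums of coroot values over roots *)
Section RootSums.
Variables (K : numFieldType) (g : finLieType K) (H : {vspace g}) (n : nat).
Variables (rts : seq (hdual H)) (alpha omega : 'I_n -> hdual H).
Variables (x : hdual H -> g) (h : 'I_n -> subvs_of H) (co : hdual H -> subvs_of H).
Hypothesis RD : root_datum rts alpha omega x h co.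
Implicit Types (mu nu beta : hdual H) (t : subvs_of H) (i j : 'I_n).

Local Notation y_ := (coweight alpha omega h).
Local Notation adj := (adjoint_rep g).

Lemma hdual_mulrn_eq0 mu k : (mu *+ k == 0) = (mu == 0) || (k == 0)%N.
Proof.
by rewrite -scaler_nat scaler_eq0 pnatr_eq0 orbC.
Qed.

(** Applied to a vector of weight nu, the powers of ad y have the pairwise
    distinct weights nu + N mu, and only finitely many of these are roots
    or zero. *)
Lemma ad_root_nilpotent mu y : mu \in rts -> root_space mu y ->
  forall z, exists N, iter N (lie y) z = 0.
Proof.
move=> mu_rt hy.
have iter_lin N a u v :
    iter N (lie y) (a *: u + v) = a *: iter N (lie y) u + iter N (lie y) v.
  by elim: N => //= N ->; rewrite lie_linearr.
have iter0 N : iter N (lie y) 0 = 0 by elim: N => //= N ->; rewrite (rep0r adj).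
have nil nu z : root_space nu z -> exists N, iter N (lie y) z = 0.
  move=> hz; apply: contrapT => /forallNP nz.
  have hN N : root_space (mu *+ N + nu) (iter N (lie y) z).
    elim: N => [|N IHN]; first by rewrite add0r.
    by rewrite iterS mulrS -addrA; exact: (hweight_root adj).
  (* One weight more than there are roots, plus one because 0 is allowed. *)
  pose s := mkseq (fun N => mu *+ N + nu) (size rts).+2.
  have : (size s <= size (0%R :: rts))%N.
    apply: uniq_leq_size.
      rewrite mkseq_uniq // => N M /= /addIr.
      wlog /subnKC <- : N M / (N <= M)%N.
        by move=> W; case: (leqP N M) => [/W//|/ltnW/W W' /esym/W'].
      move=> /esym/eqP; rewrite mulrnDr addrC -subr_eq0 addrK hdual_mulrn_eq0.
      by rewrite (negPf (root_neq0 RD mu_rt)) => /eqP ->; rewrite addn0.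
    move=> _ /mapP[N _ ->]; rewrite inE; case: eqVneq => //= w0.
    by apply: (root_mem RD w0 _ (hN N)); apply/eqP/nz.
  by rewrite size_mkseq /= ltnn.
elim/(root_basis_ind RD).
- move=> a u v [N hu] [M hv]; exists (N + M)%N.
  by rewrite iter_lin addnC iterD hu iter0 scaler0 add0r addnC iterD hv iter0.
- by exists 0%N.
- by move=> nu nu_rt; apply: (nil nu); exact: (rd_root_vector RD).
- by move=> i; apply: (nil 0); exact: (cartan_weight0 RD).
Qed.

Lemma coroot_sl2 mu : mu \in rts ->
  [/\ lie (x mu) (x (- mu)) = vsval (co mu),
      lie (vsval (co mu)) (x (- mu)) = (- 2) *: x (- mu)
    & lie (vsval (co mu)) (x mu) = 2 *: x mu].
Proof.
move=> mu_rt; split; first exact: (rd_coroot RD).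
  by rewrite (rd_root_vector RD (root_oppr RD mu_rt)) hevalN (rd_coroot2 RD).
by rewrite (rd_root_vector RD mu_rt) (rd_coroot2 RD).
Qed.

Lemma root_coroot_real mu beta : mu \in rts -> beta \in rts ->
  heval beta (co mu) \is Num.real.
Proof.
move=> mu_rt beta_rt; have [ef hf he] := coroot_sl2 mu_rt.
have muN_rt := root_oppr RD mu_rt.
apply: (sl2_weight_real adj ef hf he (root_vector_neq0 RD beta_rt)).
- exact: (rd_root_vector RD).
- exact: (ad_root_nilpotent mu_rt (rd_root_vector RD mu_rt)).
- exact: (ad_root_nilpotent muN_rt (rd_root_vector RD muN_rt)).
Qed.

(** Translation by a is a bijection from the elements of S with predecessor in S to
    those with successor in S, and phi contributes nothing elsewhere. *)
Lemma sum_shift (S : seq (hdual H)) (a : hdual H) (phi : hdual H -> K) :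
  uniq S ->
  (forall b, b \in S -> b - a \notin S -> phi (b - a) = 0) ->
  (forall b, b \in S -> b + a \notin S -> phi b = 0) ->
  \sum_(b <- S) phi (b - a) = \sum_(b <- S) phi b.
Proof.
move=> uS phiN phiP.
rewrite (bigID (fun b => b - a \in S)) /= [X in _ + X]big_seq_cond.
rewrite [X in _ + X]big1 ?addr0 => [|b /andP[bS]]; last exact: phiN.
rewrite [RHS](bigID (fun b => b + a \in S)) /= [X in _ = _ + X]big_seq_cond.
rewrite [X in _ = _ + X]big1 ?addr0 => [|b /andP[bS]]; last exact: phiP.
rewrite -big_filter -[RHS]big_filter -(big_map (fun b => b - a) predT phi).
apply: perm_big; apply: uniq_perm.
- by rewrite map_inj_uniq ?filter_uniq //; exact: addIr.
- by rewrite filter_uniq.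
move=> b; apply/mapP/idP => [[c]|].
  by rewrite !mem_filter => /andP[caS cS] ->; rewrite subrK cS caS.
rewrite mem_filter => /andP[baS bS]; exists (b + a); last by rewrite addrK.
by rewrite mem_filter addrK bS baS.
Qed.

(** The span of the root vectors of S is stable under the sl2 attached to mu, and
    the sum is the trace of the commutator h_mu = [e, f] on it.  In coordinates,
    phi b is the eigenvalue of f e on x_b and phi (b - mu) that of e f, so that the
    sum telescopes along mu-strings. *)
Lemma coroot_trace mu (S : seq (hdual H)) : mu \in rts -> uniq S ->
  {subset S <= rts} -> - mu \notin S -> mu \notin S ->
  (forall b, b \in S -> b + mu \in rts -> b + mu \in S) ->
  (forall b, b \in S -> b - mu \in rts -> b - mu \in S) ->
  \sum_(b <- S) heval b (co mu) = 0.
Proof.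
move=> mu_rt uS Srts muNS muS Sadd Ssub; have muN_rt := root_oppr RD mu_rt.
have coef m b : exists c : K, m \in rts -> b \in rts -> m + b != 0 ->
    lie (x m) (x b) = c *: x (m + b) /\ (m + b \notin rts -> c = 0).
  case: (boolP [&& m \in rts, b \in rts & m + b != 0]) => [/and3P[m_rt b_rt mb]|].
    by have [c cP] := lie_root_root RD m_rt b_rt mb; exists c.
  by move=> N; exists 0 => m_rt b_rt mb; case/negP: N; rewrite m_rt b_rt mb.
have [a aP] := choice (coef mu); have [a' a'P] := choice (coef (- mu)).
pose phi b := a b * a' (mu + b).
have neqS b : b \in S -> mu + b != 0 /\ - mu + b != 0.
  move=> bS; split.
    by apply: contraNneq muNS => /eqP; rewrite addrC addr_eq0 => /eqP <-.
  by apply: contraNneq muS => /eqP; rewrite addrC subr_eq0 => /eqP <-.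
have ev b : b \in S -> heval b (co mu) = phi (b - mu) - phi b.
  move=> bS; have b_rt := Srts _ bS; have [mb mNb] := neqS _ bS.
  have [eb eb0] := aP b mu_rt b_rt mb; have [fb fb0] := a'P b muN_rt b_rt mNb.
  have ef : lie (x mu) (lie (x (- mu)) (x b)) = phi (b - mu) *: x b.
    rewrite /phi subrKC fb (repZr adj) [b - mu]addrC.
    have [mNb_rt|/fb0 ->] := boolP (- mu + b \in rts); last by rewrite mulr0 !scale0r.
    have [|-> _] := aP (- mu + b) mu_rt mNb_rt.
      by rewrite addrA subrr add0r; exact: (root_neq0 RD).
    by rewrite addrA subrr add0r scalerA mulrC.
  have fe : lie (x (- mu)) (lie (x mu) (x b)) = phi b *: x b.
    rewrite /phi eb (repZr adj).
    have [mb_rt|/eb0 ->] := boolP (mu + b \in rts); last by rewrite mul0r !scale0r.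
    have [|-> _] := a'P (mu + b) muN_rt mb_rt.
      by rewrite addrA addNr add0r; exact: (root_neq0 RD).
    by rewrite addrA addNr add0r scalerA.
  have := rep_lie adj (x mu) (x (- mu)) (x b).
  rewrite (rd_coroot RD mu_rt) ef fe (rd_root_vector RD b_rt) -scalerBl.
  move=> /eqP; rewrite -subr_eq0 -scalerBl scaler_eq0.
  by rewrite (negPf (root_vector_neq0 RD b_rt)) orbF subr_eq0 => /eqP.
rewrite big_seq (eq_bigr (fun b => phi (b - mu) - phi b)) => [|b /ev //].
rewrite -big_seq sumrB (sum_shift uS) ?subrr // => b bS bN.
  have [_ mNb] := neqS _ bS; rewrite /phi subrKC.
  have [_ ->] := a'P b muN_rt (Srts _ bS) mNb; first by rewrite mulr0.
  by rewrite addrC; apply: contra bN; exact: Ssub.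
have [mb _] := neqS _ bS; rewrite /phi.
have [_ ->] := aP b mu_rt (Srts _ bS) mb; first by rewrite mul0r.
by rewrite addrC; apply: contra bN; exact: Sadd.
Qed.

(** This is 2 rho(h_i) > 0.  The roots with a positive coefficient on some alpha_j,
    j != i, are positive and stable under translation by alpha_i inside the set
    of roots, so they contribute 0 by [coroot_trace].  The remaining positive roots
    are multiples k alpha_i, which contribute 2k, and alpha_i is one of them. *)
Lemma sum_positive_coroot_gt0 i :
  0 < \sum_(b <- positive_roots rts alpha) heval b (h i).
Proof.
pose Sp b := [exists j, (j != i) && (0 < heval b (y_ j))].
have y_simple j : j != i -> heval (alpha i) (y_ j) = 0.
  by move=> /negPf ji; rewrite (coweight_alpha RD) eq_sym ji.
have Sp_shift b c : Sp (b + c *: alpha i) = Sp b.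
  apply: eq_existsb => j; case: (boolP (j != i)) => //= ji.
  by rewrite hevalD hevalZ y_simple // mulr0 addr0.
have ai_rt := simple_root_mem RD i.
have Sp0 c : ~~ Sp (c *: alpha i).
  rewrite -[c *: _]add0r Sp_shift; apply/existsP => -[j].
  by rewrite heval0 ltxx andbF.
have Sp_pos b : b \in rts -> Sp b -> b \in positive_roots rts alpha.
  move=> b_rt /existsP[j /andP[ji bj]].
  have [//|/positive_rootP[_ /(coweight_nat_span RD)/(_ j)[k]]] := positive_rootVN RD b_rt.
  by rewrite hevalN => /eqP; rewrite eqr_oppLR => /eqP bk; move: bj; rewrite bk oppr_gt0 ltrn0.
rewrite (bigID Sp) /= [X in X + _](_ : _ = 0) ?add0r; last first.
  rewrite -big_filter /positive_roots -filter_predI.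
  rewrite (@eq_in_filter _ _ Sp) => [|b b_rt /=]; last first.
    case: (boolP (Sp b)) => //= /(Sp_pos _ b_rt).
    by rewrite mem_filter => /andP[].
  rewrite (rd_simple_coroot RD); apply: coroot_trace => //.
  - by rewrite filter_uniq //; case: (rd_roots RD).
  - exact: mem_subseq (filter_subseq _ _).
  - by rewrite mem_filter -scaleN1r (negPf (Sp0 _)).
  - by rewrite mem_filter -[alpha i]scale1r (negPf (Sp0 _)).
  - by move=> b; rewrite !mem_filter -{2}[alpha i]scale1r Sp_shift => /andP[-> _].
  - by move=> b; rewrite !mem_filter -{2}[alpha i]scale1r -scaleNr Sp_shift => /andP[-> _].
have term b : b \in positive_roots rts alpha -> ~~ Sp b ->
    heval b (h i) = 2 * heval b (y_ i) /\ 0 <= heval b (y_ i).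
  move=> /positive_rootP[_ /(coweight_nat_span RD) bn] /existsPn bS.
  split; last by have [k ->] := bn i.
  rewrite {1}[b](simple_decomp RD) heval_sum (bigD1 i) //= big1 => [|j ji].
    by rewrite hevalZ (rd_simple_coroot RD) (rd_coroot2 RD) // addr0 mulrC.
  have [[|k] bk] := bn j; first by rewrite bk scale0r heval0.
  by have := bS j; rewrite ji bk ltr0Sn.
have ai_pos := simple_root_positive RD i.
have ai_S : ~~ Sp (alpha i) by rewrite -[alpha i]scale1r.
(* The term of alpha_i is 2 and the others are nonnegative. *)
rewrite (big_rem (alpha i)) //= ai_S /=.
apply: ltr_wpDr.
  rewrite big_seq_cond; apply: sumr_ge0 => b /andP[/mem_rem b_pos bS].
  by have [-> ?] := term b b_pos bS; rewrite mulr_ge0.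
by have [-> _] := term _ ai_pos ai_S; rewrite (coweight_alpha RD) eqxx mulr1.
Qed.

End RootSums.

(** * The Killing form *)

Section Trace.
Variables (K : fieldType) (T : vectType K) (X : seq T).

(** Taken of a bare function in a given basis: the adjoint maps, which are its
    only arguments below, then need not be packaged as endomorphisms. *)
Definition basis_trace (F : T -> T) : K :=
  \sum_(k < size X) coord (in_tuple X) k (F X`_k).

Lemma basis_traceC (F G : T -> T) : basis_of fullv X -> linear F -> linear G ->
  basis_trace (F \o G) = basis_trace (G \o F).
Proof.
move=> bX Flin Glin.
have expand (f : T -> T) u : linear f ->
    f u = \sum_(l < size X) coord (in_tuple X) l u *: f X`_l.
  move=> flin.
  have fD v w : f (v + w) = f v + f w by rewrite -[v]scale1r flin !scale1r.
  have f0 : f 0 = 0 by apply: (addrI (f 0)); rewrite -fD !addr0.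
  rewrite {1}(@coord_basis _ _ fullv _ (in_tuple X) u bX (memvf u)).
  rewrite (big_morph f fD f0); apply: eq_bigr => l _.
  by rewrite -[_ *: _]addr0 flin f0 addr0.
rewrite /basis_trace.
under eq_bigr => k _ do rewrite /= (expand F) // linear_sum.
rewrite exchange_big /=; apply: eq_bigr => l _.
rewrite (expand G (F _)) // linear_sum; apply: eq_bigr => k _.
by rewrite !linearZ /= mulrC.
Qed.

End Trace.

Section Killing.
Variables (K : fieldType) (g : finLieType K) (X : seq g).
Hypothesis bX : basis_of fullv X.
Local Notation adj := (adjoint_rep g).

Definition killing (a b : g) : K := basis_trace X (fun z => lie a (lie b z)).

Lemma killing_linear b : linear (killing b : g -> K^o).
Proof.
move=> c y z; rewrite /killing /basis_trace scaler_sumr -big_split.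
apply: eq_bigr => k _ /=.
by rewrite (repDl adj) (repZl adj) lie_linearr linearP.
Qed.

Lemma killingC a b : killing a b = killing b a.
Proof.
by apply: (basis_traceC bX); [exact: lie_linearr | exact: lie_linearr].
Qed.

(** Expanding both brackets as commutators of adjoint maps, one term is common
    and the other two agree by cyclicity of the trace. *)
Lemma killing_inv a b c : killing (lie a b) c = killing a (lie b c).
Proof.
have lin2 (a' b' : g) : linear (fun z : g => lie a' (lie b' z)).
  by move=> k u v; rewrite !lie_linearr.
rewrite /killing /basis_trace.
under eq_bigr => k _ do rewrite (rep_lie adj) linearB.
under [RHS]eq_bigr => k _ do rewrite (rep_lie adj) (repDr adj) (repNr adj) linearB.
rewrite !sumrB; congr (_ - _).
by have := basis_traceC bX (lie_linearr b) (lin2 a c); rewrite /basis_trace /=.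
Qed.

Lemma killingDr a : {morph killing a : b c / b + c}.
Proof. by move=> b c; have := killing_linear a 1 b c; rewrite !scale1r. Qed.

Lemma killing0r a : killing a 0 = 0.
Proof. by apply: (addrI (killing a 0)); rewrite -killingDr !addr0. Qed.

Lemma killingZr a k b : killing a (k *: b) = k * killing a b.
Proof. by have := killing_linear a k b 0; rewrite !addr0 killing0r addr0. Qed.

Lemma killingZl a k b : killing (k *: a) b = k * killing a b.
Proof. by rewrite killingC killingZr killingC. Qed.

Lemma killingNl a b : killing (- a) b = - killing a b.
Proof. by rewrite -scaleN1r killingZl mulN1r. Qed.

(** By invariance, every t in H multiplies the pairing by mu(t) and by -nu(t). *)
Lemma killing_orth (H : {vspace g}) (mu nu : hdual H) y z :
  root_space mu y -> root_space nu z -> mu + nu != 0 -> killing y z = 0.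
Proof.
move=> hy hz /heval_neq[t]; rewrite heval0 hevalD => mnt.
have := killing_inv y (vsval t) z; rewrite hz killingZr.
rewrite lie_antisym hy killingNl killingZl => E.
have : (heval mu t + heval nu t) * killing y z == 0 by rewrite mulrDl -E subrr.
by rewrite mulf_eq0 (negPf mnt) => /eqP.
Qed.

End Killing.

(** * The Casimir operator *)

(** The Casimir element is given by a list of pairs which forms a pair of bases
    dual for the Killing form. *)
Section Casimir.
Variables (K : fieldType) (g : finLieType K) (X : seq g).
Hypothesis bX : basis_of fullv X.
Variable s : seq (g * g).
Hypothesis dual1 : forall z, z = \sum_(p <- s) killing X z p.2 *: p.1.
Hypothesis dual2 : forall z, z = \sum_(p <- s) killing X z p.1 *: p.2.
Variables (V : lmodType K) (act : g -> V -> V).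
Hypothesis rV : lie_rep act.

Definition casimir (v : V) : V := \sum_(p <- s) act p.1 (act p.2 v).

(** Expanding [y, X_a] on the X_b and [y, X^a] on the X^b, the coefficients of
    X_b X^a in the commutator of y with the Casimir element are
    opposite by invariance of the form. *)
Lemma casimir_comm y v : casimir (act y v) = act y (casimir v).
Proof.
apply/esym/eqP; rewrite -subr_eq0 /casimir (rep_sumr rV) -sumrB; apply/eqP.
transitivity (\sum_(p <- s) (act (lie y p.1) (act p.2 v) +
                             act p.1 (act (lie y p.2) v))).
  apply: eq_bigr => p _; rewrite !(rep_lie rV) (repDr rV) (repNr rV).
  by rewrite addrA subrK.
rewrite big_split /=.
under eq_bigr => p _ do rewrite {1}(dual1 (lie y p.1)) (rep_suml rV).
under [X in _ + X]eq_bigr => p _ do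
  rewrite {1}(dual2 (lie y p.2)) (rep_suml rV) (rep_sumr rV).
rewrite exchange_big -big_split /= big1 // => q _.
rewrite -big_split /= big1 // => p _.
rewrite !(repZl rV) (repZr rV) -scalerDl.
rewrite [X in _ + X](_ : _ = - killing X (lie y p.1) q.2) ?subrr ?scale0r //.
by rewrite (killingC bX) -(killing_inv bX) lie_antisym (killingNl bX).
Qed.

End Casimir.

Section RootCasimir.
Variables (K : numFieldType) (g : finLieType K) (H : {vspace g}) (n : nat).
Variables (rts : seq (hdual H)) (alpha omega : 'I_n -> hdual H).
Variables (x : hdual H -> g) (h : 'I_n -> subvs_of H) (co : hdual H -> subvs_of H).
Hypothesis RD : root_datum rts alpha omega x h co.
Implicit Types (mu nu lam beta b : hdual H) (t : subvs_of H) (i j : 'I_n).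

Local Notation y_ := (coweight alpha omega h).
Local Notation adj := (adjoint_rep g).
Local Notation pos := (positive_roots rts alpha).

Definition root_basis :=
  [seq x mu | mu <- rts] ++ [seq vsval (h i) | i <- enum 'I_n].

Let bX : basis_of fullv root_basis := rd_basis RD.
Local Notation kappa := (killing root_basis).

Definition root_norm mu : K := kappa (x mu) (x (- mu)).

Lemma root_normN mu : root_norm (- mu) = root_norm mu.
Proof. by rewrite /root_norm opprK (killingC bX). Qed.

(** Moving t across the bracket [x_mu, x_(-mu)] = h_mu. *)
Lemma killing_coroot mu t : mu \in rts ->
  kappa (vsval (co mu)) (vsval t) = heval mu t * root_norm mu.
Proof.
move=> mu_rt; rewrite -(rd_coroot RD mu_rt) (killing_inv bX).
by rewrite (lie_root_cartan RD) ?(root_oppr RD) // hevalN opprK killingZr.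
Qed.

(** (h_mu, h_mu) is the sum of the squares of the eigenvalues of ad h_mu; these
    are real, and one of them is 2.  It is also 2 (x_mu, x_(-mu)) by
    [killing_coroot]. *)
Lemma root_norm_gt0 mu : mu \in rts -> 0 < root_norm mu.
Proof.
move=> mu_rt; suff : 0 < kappa (vsval (co mu)) (vsval (co mu)).
  by rewrite killing_coroot // (rd_coroot2 RD) // pmulr_rgt0.
have ev (k : 'I_(size root_basis)) : exists2 c : K, c \is Num.real &
    lie (vsval (co mu)) root_basis`_k = c *: root_basis`_k.
  have : root_basis`_k \in root_basis by apply: mem_nth.
  rewrite mem_cat => /orP[/mapP[b b_rt ->]|/mapP[i _ ->]].
    exists (heval b (co mu)); first exact: (root_coroot_real RD).
    exact: (rd_root_vector RD).
  by exists 0; rewrite ?rpred0 // (cartan_weight0 RD) heval0.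
have coordk (k : 'I_(size root_basis)) :
    coord (in_tuple root_basis) k root_basis`_k = 1.
  by rewrite (coord_free k k (basis_free bX : free (in_tuple _))) eqxx.
have xmu : x mu \in root_basis by rewrite mem_cat map_f.
have k0P : (index (x mu) root_basis < size root_basis)%N by rewrite index_mem.
(* The term of x_mu is 2 ^ 2 and the others are squares of reals. *)
rewrite /killing /basis_trace (bigD1 (Ordinal k0P)) //=.
apply: ltr_wpDr.
  apply: sumr_ge0 => k _; have [c c_real ck] := ev k.
  rewrite ck (repZr adj) ck scalerA linearZ /= coordk mulr1 -expr2.
  by rewrite real_exprn_even_ge0.
rewrite nth_index // (rd_root_vector RD mu_rt) (repZr adj).
rewrite (rd_root_vector RD mu_rt) (rd_coroot2 RD) // scalerA linearZ /=.
rewrite -{2}[x mu](nth_index 0 xmu) coordk.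
by rewrite mulr1 mulr_gt0.
Qed.

Lemma root_norm_neq0 mu : mu \in rts -> root_norm mu != 0.
Proof. by move/root_norm_gt0/lt0r_neq0. Qed.

Local Notation c_ := root_norm.

(** The form pairs g_mu with g_(-mu) only, and on H it satisfies
    (h_i, t) = c_i alpha_i(t), whence the coweights in the dual basis. *)
Definition dual_pairs : seq (g * g) :=
  [seq (x mu, (c_ mu)^-1 *: x (- mu)) | mu <- rts] ++
  [seq (vsval (h i), (c_ (alpha i))^-1 *: vsval (y_ i)) | i <- enum 'I_n].

Lemma sum_dual_pairs (W : nmodType) (F : g * g -> W) :
  \sum_(p <- dual_pairs) F p =
  \sum_(mu <- rts) F (x mu, (c_ mu)^-1 *: x (- mu)) +
  \sum_i F (vsval (h i), (c_ (alpha i))^-1 *: vsval (y_ i)).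
Proof. by rewrite big_cat big_map; congr (_ + _); rewrite big_map big_enum. Qed.

Let killing_h i t : kappa (vsval (h i)) (vsval t) = heval (alpha i) t * c_ (alpha i).
Proof. by rewrite (rd_simple_coroot RD) killing_coroot // (simple_root_mem RD). Qed.

Let killing_root_cartan mu t : mu \in rts -> kappa (x mu) (vsval t) = 0.
Proof.
move=> mu_rt; apply: (killing_orth bX (rd_root_vector RD mu_rt) (cartan_weight0 RD t)).
by rewrite addr0 (root_neq0 RD).
Qed.

Let killing_root_root mu nu : mu \in rts -> nu \in rts -> nu != - mu ->
  kappa (x mu) (x nu) = 0.
Proof.
move=> mu_rt nu_rt neq; apply: (killing_orth bX (rd_root_vector RD mu_rt)).
  exact: (rd_root_vector RD).
by rewrite addrC addr_eq0.
Qed.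

Let rts_uniq : uniq rts. Proof. by case: (rd_roots RD). Qed.

Lemma dual_pairs_left z : z = \sum_(p <- dual_pairs) kappa z p.2 *: p.1.
Proof.
elim/(root_basis_ind RD): z => [a y z hy hz||nu nu_rt|j].
- rewrite {1}hy {1}hz scaler_sumr -big_split; apply: eq_bigr => p _ /=.
  rewrite scalerA -scalerDl ![kappa _ p.2](killingC bX).
  by rewrite killingDr killingZr.
- by rewrite big1 // => p _; rewrite (killingC bX) killing0r scale0r.
- rewrite sum_dual_pairs /= [X in _ + X]big1 ?addr0 => [|i _]; last first.
    by rewrite killingZr killing_root_cartan // mulr0 scale0r.
  rewrite (bigD1_seq nu) //= killingZr mulVf ?root_norm_neq0 // scale1r.
  rewrite big_seq_cond big1 ?addr0 // => mu /andP[mu_rt mu_nu].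
  rewrite killingZr killing_root_root ?mulr0 ?scale0r ?(root_oppr RD) //.
  by rewrite eqr_opp.
- rewrite sum_dual_pairs /= big_seq big1 ?add0r => [|mu mu_rt]; last first.
    rewrite killingZr (killingC bX) killing_root_cartan ?(root_oppr RD) //.
    by rewrite mulr0 scale0r.
  rewrite (bigD1 j) //= killingZr killing_h (coweight_alpha RD).
  rewrite eqxx mul1r mulVf ?root_norm_neq0 ?(simple_root_mem RD) // scale1r.
  rewrite big1 ?addr0 // => i /negPf ij.
  by rewrite killingZr killing_h (coweight_alpha RD) eq_sym ij mul0r mulr0 scale0r.
Qed.

Lemma dual_pairs_right z : z = \sum_(p <- dual_pairs) kappa z p.1 *: p.2.
Proof.
elim/(root_basis_ind RD): z => [a y z hy hz||nu nu_rt|j].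
- rewrite {1}hy {1}hz scaler_sumr -big_split; apply: eq_bigr => p _ /=.
  rewrite scalerA -scalerDl ![kappa _ p.1](killingC bX).
  by rewrite killingDr killingZr.
- by rewrite big1 // => p _; rewrite (killingC bX) killing0r scale0r.
- rewrite sum_dual_pairs /= [X in _ + X]big1 ?addr0 => [|i _]; last first.
    by rewrite killing_root_cartan // scale0r.
  rewrite (bigD1_seq (- nu)) ?(root_oppr RD) //= root_normN opprK scalerA.
  rewrite mulfV ?root_norm_neq0 // scale1r.
  rewrite big_seq_cond big1 ?addr0 // => mu /andP[mu_rt mu_nu].
  by rewrite killing_root_root // scale0r.
- rewrite sum_dual_pairs /= big_seq big1 ?add0r => [|mu mu_rt]; last first.
    by rewrite (killingC bX) killing_root_cartan // scale0r.
  rewrite {1}(coweight_decomp RD (h j)) linear_sum; apply: eq_bigr => i _.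
  rewrite (killingC bX) killing_h scalerA mulfK ?linearZ //.
  by rewrite root_norm_neq0 // (simple_root_mem RD).
Qed.

(** This is (mu, 2 rho) + (mu, mu), written without inverting the form on H. *)
Definition casimir_value mu : K :=
  \sum_(b <- pos) heval mu (co b) / c_ b +
  \sum_i heval mu (h i) * heval mu (y_ i) / c_ (alpha i).

(** In the term of a root b, either x_(-b) kills v, or x_b does and
    x_b x_(-b) v = [x_b, x_(-b)] v = mu(h_b) v. *)
Lemma casimir_highest (V : lmodType K) (act : g -> V -> V) mu v :
    lie_rep act -> hweight act mu v ->
    (forall b, b \in pos -> act (x b) v = 0) ->
  casimir dual_pairs act v = casimir_value mu *: v.
Proof.
move=> rV hv xv; rewrite /casimir sum_dual_pairs /= /casimir_value scalerDl.
congr (_ + _).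
  rewrite big_filter scaler_suml [RHS]big_mkcond big_seq [RHS]big_seq.
  apply: eq_bigr => b b_rt; rewrite (repZl rV) (repZr rV).
  have b_pos : `[< nat_span alpha b >] = (b \in pos) by rewrite mem_filter b_rt andbT.
  rewrite b_pos; case: ifPn => [bp|bNp].
    rewrite (rep_swap rV) xv // (rep0r rV) add0r (rd_coroot RD b_rt) hv.
    by rewrite scalerA mulrC.
  case: (positive_rootVN RD b_rt) => [bp|bp]; first by rewrite bp in bNp.
  by rewrite (xv _ bp) (rep0r rV) scaler0.
rewrite scaler_suml; apply: eq_bigr => i _.
rewrite (repZl rV) (repZr rV) hv (repZr rV) hv !scalerA; congr (_ *: _).
by rewrite -mulrA mulrC [heval mu (h i) * _]mulrC.
Qed.

(** Both sides are the pairing (beta, b): on the left through the coroot of b, on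
    the right by expanding beta on the simple roots.  For beta = alpha_j this is
    the symmetry of (h_j, h_b). *)
Lemma coroot_coweight beta b : b \in rts ->
  heval beta (co b) / c_ b =
  \sum_j heval beta (y_ j) / c_ (alpha j) * heval b (h j).
Proof.
move=> b_rt; rewrite {1}[beta](simple_decomp RD) heval_sum mulr_suml.
apply: eq_bigr => j _; rewrite hevalZ -!mulrA; congr (_ * _).
have cb := root_norm_neq0 b_rt; have cj := root_norm_neq0 (simple_root_mem RD j).
apply: (mulfI cj); rewrite !mulrA mulfV // mul1r.
by rewrite [c_ _ * _]mulrC -killing_h (killingC bX) killing_coroot // mulfK.
Qed.

(** (lam, lam + 2 rho) - (mu, mu + 2 rho) = (lam + mu + 2 rho, beta), with the factor
    beta expanded on the simple roots. *)
Lemma casimir_valueB lam mu (beta := lam - mu) :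
  casimir_value lam - casimir_value mu =
  \sum_j heval beta (y_ j) / c_ (alpha j) *
    (heval lam (h j) + heval mu (h j) + \sum_(b <- pos) heval b (h j)).
Proof.
have pairing nu : \sum_i heval beta (h i) * heval nu (y_ i) / c_ (alpha i) =
    \sum_j heval beta (y_ j) / c_ (alpha j) * heval nu (h j).
  under eq_bigr => i _.
    rewrite mulrAC (rd_simple_coroot RD) coroot_coweight ?(simple_root_mem RD) // mulr_suml.
  over.
  rewrite exchange_big; apply: eq_bigr => j _ /=.
  rewrite [in RHS](simple_decomp RD nu) heval_sum mulr_sumr; apply: eq_bigr => i _.
  by rewrite hevalZ -!mulrA [_ * heval nu _]mulrC.
rewrite /casimir_value opprD addrACA -!sumrB.
under eq_bigr => b _ do rewrite -mulrBl -hevalB.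
rewrite big_seq (eq_bigr (fun b =>
  \sum_j heval beta (y_ j) / c_ (alpha j) * heval b (h j))); last first.
  by move=> b /positive_rootP[b_rt _]; exact: coroot_coweight.
rewrite -big_seq exchange_big /=.
have -> : \sum_i (heval lam (h i) * heval lam (y_ i) / c_ (alpha i) -
              heval mu (h i) * heval mu (y_ i) / c_ (alpha i)) =
  \sum_i heval beta (h i) * heval mu (y_ i) / c_ (alpha i) +
  \sum_j heval beta (y_ j) / c_ (alpha j) * heval lam (h j).
  rewrite -big_split; apply: eq_bigr => i _ /=.
  by rewrite !hevalB; ring.
rewrite pairing -!big_split; apply: eq_bigr => j _ /=.
by rewrite -mulr_sumr -!mulrDr; congr (_ * _); rewrite addrC [_ + heval lam _]addrC.
Qed.

Lemma casimir_value_inj lam mu :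
  (forall i, 0 <= heval lam (h i)) -> (forall i, 0 <= heval mu (h i)) ->
  weight_le alpha mu lam -> casimir_value lam = casimir_value mu -> lam = mu.
Proof.
move=> lam_ge0 mu_ge0 /(coweight_nat_span RD) mu_lam /eqP.
rewrite -subr_eq0 casimir_valueB; set F := BIG_F.
have c_gt0 j : 0 < c_ (alpha j) by rewrite root_norm_gt0 // (simple_root_mem RD).
have br_gt0 j : 0 < heval lam (h j) + heval mu (h j) + \sum_(b <- pos) heval b (h j).
  by rewrite ltr_wpDl ?addr_ge0 // (sum_positive_coroot_gt0 RD).
have F_ge0 j : 0 <= F j.
  rewrite mulr_ge0 ?(ltW (br_gt0 j)) // divr_ge0 ?(ltW (c_gt0 j)) //.
  by have [k ->] := mu_lam j.
rewrite psumr_eq0 => [/allP F0|j _]; last exact: F_ge0.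
apply/eqP; rewrite -subr_eq0 [lam - mu](simple_decomp RD) big1 // => j _.
have := F0 j (mem_index_enum j); rewrite implyTb mulf_eq0 (gt_eqF (br_gt0 j)) orbF.
rewrite mulf_eq0 invr_eq0 (gt_eqF (c_gt0 j)) orbF => /eqP ->.
by rewrite scale0r.
Qed.

End RootCasimir.

(** * Lower triangular spans in current algebra modules *)

Section CurrentAction.
Variables (K : fieldType) (g : lieType K) (A : pzRingType) (V : lmodType K).

(** [op y a] is the action of y (x) a.  A module over g alone is the case A = K, with
    [op y a v] equal to a times y v, so that both g (x) A-modules and g-modules are
    covered by the lemmas on [lower_span]. *)
Record current_action (op : g -> A -> V -> V) : Prop := CurrentAction {
  act_linl : forall a v, linear (fun y => op y a v);
  act_linr : forall y a, linear (op y a);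
  act_lie : forall y z a b v,
    op (lie y z) (a * b) v = op y a (op z b v) - op z b (op y a v)
}.

Lemma lie_rep_current (op : g -> A -> V -> V) :
  current_action op -> lie_rep (fun y => op y 1).
Proof.
move=> aV; split=> [v|y|y z v]; [exact: (act_linl aV)|exact: (act_linr aV)|].
by rewrite -(act_lie aV) mulr1.
Qed.

End CurrentAction.

Section LowerSpan.
Variables (K : numFieldType) (g : finLieType K) (H : {vspace g}) (n : nat).
Variables (rts : seq (hdual H)) (alpha omega : 'I_n -> hdual H).
Variables (x : hdual H -> g) (h : 'I_n -> subvs_of H) (co : hdual H -> subvs_of H).
Hypothesis RD : root_datum rts alpha omega x h co.
Implicit Types (mu nu b : hdual H) (t : subvs_of H) (i j : 'I_n).
Local Notation pos := (positive_roots rts alpha).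

Lemma nat_spanD mu nu : nat_span alpha mu -> nat_span alpha nu ->
  nat_span alpha (mu + nu).
Proof.
move=> [c ->] [d ->]; exists (fun i => c i + d i)%N.
by rewrite -big_split; apply: eq_bigr => i _; rewrite mulrnDr.
Qed.

Lemma weight_le_refl mu : weight_le alpha mu mu.
Proof. by exists (fun=> 0%N); rewrite subrr big1. Qed.

Lemma weight_le_lower mu lam b : b \in pos -> weight_le alpha mu lam ->
  weight_le alpha (mu - b) lam.
Proof.
by move=> /positive_rootP[_ bp] ml; rewrite /weight_le opprB addrCA; exact: nat_spanD.
Qed.

Lemma weight_lower_neq mu lam b : b \in pos -> weight_le alpha mu lam ->
  mu - b != lam.
Proof.
move=> b_pos mu_lam; apply/eqP => eq_lam.
have /negP[] := positive_rootN RD b_pos; apply/positive_rootP; split.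
  by apply: (root_oppr RD); case/positive_rootP: b_pos.
by move: mu_lam; rewrite /weight_le -eq_lam addrC addKr.
Qed.

Variables (A : pzRingType) (V : lmodType K) (op : g -> A -> V -> V).
Hypothesis aV : current_action op.
Variables (v0 : V) (lam : hdual H).

(** The span of v0 under products of elements of (n^- + h) (x) A. *)
Inductive lower_span : V -> Prop :=
| lower_gen : lower_span v0
| lower_lin k u v : lower_span u -> lower_span v -> lower_span (k *: u + v)
| lower_root b a u : b \in pos -> lower_span u -> lower_span (op (x (- b)) a u)
| lower_cartan t a u : lower_span u -> lower_span (op (vsval t) a u).

Lemma lower_span0 : lower_span 0.
Proof.
by rewrite -(addNr v0) -scaleN1r; apply: lower_lin; exact: lower_gen.
Qed.

Lemma lower_spanZ k u : lower_span u -> lower_span (k *: u).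
Proof. by move=> hu; rewrite -[_ *: _]addr0; apply: lower_lin hu lower_span0. Qed.

Lemma lower_spanD u v : lower_span u -> lower_span v -> lower_span (u + v).
Proof. by move=> hu hv; rewrite -[u]scale1r; apply: lower_lin. Qed.

Let op_swap y a z a' v :
  op y a (op z a' v) = op z a' (op y a v) + op (lie y z) (a * a') v.
Proof. by rewrite (act_lie aV) addrC subrK. Qed.

Let opZl k y a v : op (k *: y) a v = k *: op y a v.
Proof.
have op0 : op 0 a v = 0.
  by have := act_linl aV a v (-1) 0 0; rewrite scaler0 addr0 scaleN1r addNr.
by have := act_linl aV a v k y 0; rewrite addr0 op0 addr0.
Qed.

Let op0r y a : op y a 0 = 0.
Proof.
by have := act_linr aV y a (-1) 0 0; rewrite scaler0 addr0 scaleN1r addNr.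
Qed.

Hypothesis v0_pos : forall b a, b \in pos -> op (x b) a v0 = 0.

(** Commute x_b (x) a past the outermost factor of u: the commutator lies in
    g (x) A with g-component a multiple of a root vector or a coroot, so it either
    belongs to (n^- + h) (x) A, or is again in n^+ (x) A and the induction
    hypothesis, which covers all positive roots at once, applies. *)
Lemma lower_span_raise b a u : b \in pos -> lower_span u ->
  lower_span (op (x b) a u).
Proof.
move=> b_pos hu; elim: hu b b_pos a => {u}.
- by move=> b b_pos a; rewrite v0_pos //; exact: lower_span0.
- move=> k u v _ IHu _ IHv b b_pos a; rewrite (act_linr aV).
  by apply: lower_lin; [exact: IHu | exact: IHv].
- move=> d c u d_pos hu IHu b b_pos a; rewrite op_swap; apply: lower_spanD.
    by apply: lower_root => //; exact: IHu.
  have /positive_rootP[b_rt _] := b_pos; have /positive_rootP[d_rt _] := d_pos.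
  have dN_rt := root_oppr RD d_rt.
  have [/eqP|bd0] := eqVneq (b - d) 0.
    by rewrite subr_eq0 => /eqP <-; rewrite (rd_coroot RD) //; exact: lower_cartan.
  have [c' [-> c'0]] := lie_root_root RD b_rt dN_rt bd0.
  rewrite opZl; have [bd_rt|/c'0 ->] := boolP (b - d \in rts); last first.
    by rewrite scale0r; exact: lower_span0.
  apply: lower_spanZ; case: (positive_rootVN RD bd_rt) => [bd_pos|bd_neg].
    exact: IHu.
  by rewrite -[b - d]opprK; exact: lower_root.
- move=> t c u hu IHu b b_pos a; rewrite op_swap; apply: lower_spanD.
    by apply: lower_cartan; exact: IHu.
  have /positive_rootP[b_rt _] := b_pos.
  by rewrite (lie_root_cartan RD) // opZl; apply: lower_spanZ; exact: IHu.
Qed.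

Lemma lower_span_op y a u : lower_span u -> lower_span (op y a u).
Proof.
move=> hu; elim/(root_basis_ind RD): y => [k y z hy hz||b b_rt|i].
- by rewrite (act_linl aV); exact: lower_lin.
- by rewrite -(scale0r 0) opZl scale0r; exact: lower_span0.
- case: (positive_rootVN RD b_rt) => b_pos; first exact: lower_span_raise.
  by rewrite -[b]opprK; exact: lower_root.
- exact: lower_cartan.
Qed.

Local Notation act1 := (fun y => op y 1).
Let rV : lie_rep act1 := lie_rep_current aV.

Lemma op_hweight mu nu y a u : root_space nu y -> hweight act1 mu u ->
  hweight act1 (nu + mu) (op y a u).
Proof.
move=> hy hu t; rewrite op_swap hu hy opZl mul1r.
have := act_linr aV y a (heval mu t) u 0; rewrite op0r !addr0 => ->.
by rewrite -scalerDl hevalD addrC.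
Qed.

Hypothesis v0_weight : hweight act1 lam v0.

Lemma op_weight_sum (X Y : hdual H -> Prop) nu y a u : root_space nu y ->
  (forall mu, X mu -> Y (nu + mu)) ->
  weight_sum act1 X u -> weight_sum act1 Y (op y a u).
Proof.
move=> hy XY; apply: weight_sum_map XY _ => [u1 u2||mu v _] //.
  by rewrite -[u1]scale1r (act_linr aV) !scale1r.
exact: op_hweight.
Qed.

Lemma lower_span_weights u : lower_span u ->
  weight_sum act1 (fun mu => weight_le alpha mu lam) u.
Proof.
elim=> {u} [|k u v _ hu _ hv|b a u b_pos _ hu|t a u _ hu].
- by apply: (@weight_sum_gen _ _ _ _ _ _ lam) => //; exact: weight_le_refl.
- by apply: weight_sumD => //; exact: weight_sumZ.
- have /positive_rootP[b_rt _] := b_pos.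
  apply: op_weight_sum hu; first exact: (rd_root_vector RD (root_oppr RD b_rt)).
  by move=> mu hmu; rewrite addrC; exact: weight_le_lower.
- by apply: op_weight_sum hu; [exact: (cartan_weight0 RD t)|move=> mu; rewrite add0r].
Qed.

(** Any factor from n^- strictly lowers the weight, so modulo lower weights only
    the multiples of v0 produced by H remain. *)
Lemma lower_span_top u : (forall t a, exists c, op (vsval t) a v0 = c *: v0) ->
  lower_span u ->
  exists c, weight_sum act1 (fun mu => weight_le alpha mu lam /\ mu != lam)
    (u - c *: v0).
Proof.
move=> v0_cartan.
elim=> {u} [|k u v _ [c hu] _ [d hv]|b a u b_pos hu _|t a u _ [c hu]].
- by exists 1; rewrite scale1r subrr; exact: weight_sum0.
- exists (k * c + d); rewrite scalerDl -scalerA opprD addrACA -scalerBr.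
  by apply: weight_sumD => //; exact: weight_sumZ.
- have /positive_rootP[b_rt _] := b_pos.
  exists 0; rewrite scale0r subr0; move/lower_span_weights: hu.
  apply: op_weight_sum; first exact: (rd_root_vector RD (root_oppr RD b_rt)).
  move=> mu hmu; rewrite addrC; split; first exact: weight_le_lower.
  exact: weight_lower_neq.
- have [d hd] := v0_cartan t a; exists (c * d).
  have -> : op (vsval t) a u - (c * d) *: v0 = op (vsval t) a (u - c *: v0).
    rewrite [u - _]addrC -(scaleNr c) (act_linr aV) hd.
    by rewrite scalerA mulNr scaleNr addrC.
  by apply: op_weight_sum hu; [exact: (cartan_weight0 RD t)|move=> mu; rewrite add0r].
Qed.

End LowerSpan.

(** * Simplicity of integrable highest weight modules *)

Section Integrable.
Variables (K : numFieldType) (g : finLieType K) (H : {vspace g}) (n : nat).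
Variables (rts : seq (hdual H)) (alpha omega : 'I_n -> hdual H).
Variables (x : hdual H -> g) (h : 'I_n -> subvs_of H) (co : hdual H -> subvs_of H).
Hypothesis RD : root_datum rts alpha omega x h co.
Implicit Types (mu nu b : hdual H) (t : subvs_of H) (i j : 'I_n).
Local Notation pos := (positive_roots rts alpha).
Local Notation y_ := (coweight alpha omega h).

(** The coordinates of mu on the simple roots, added up inside K. *)
Definition height mu : K := heval mu (\sum_j y_ j).

Lemma height_nat mu : nat_span alpha mu -> exists k : nat, height mu = k%:R.
Proof.
move=> /(coweight_nat_span RD)/choice[c hc]; exists (\sum_j c j)%N.
by rewrite /height heval_sumr natr_sum; apply: eq_bigr.
Qed.

Lemma height_root b : b \in pos -> exists k : nat, height b = k.+1%:R.
Proof.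
move=> b_pos; have /positive_rootP[b_rt b_span] := b_pos.
have [[|k] hk] := height_nat b_span; last by exists k.
case/eqP: (root_neq0 RD b_rt); rewrite [b](simple_decomp RD) big1 // => j _.
move: hk => /eqP; rewrite /height heval_sumr psumr_eq0 => [|i _]; last first.
  by have [l ->] := coweight_nat_span RD b_span i.
by move=> /allP/(_ j (mem_index_enum j))/eqP ->; rewrite scale0r.
Qed.

Variables (V : lmodType K) (act : g -> V -> V).
Hypothesis rV : lie_rep act.
Variables (v0 : V) (lam : hdual H).

Inductive generated : V -> Prop :=
| gen_self : generated v0
| gen_lin k u v : generated u -> generated v -> generated (k *: u + v)
| gen_act y u : generated u -> generated (act y u).

Hypotheses (v0_weight : hweight act lam v0)
  (v0_pos : forall b, b \in pos -> act (x b) v0 = 0)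
  (v0_nil : forall i, exists q, iter q (act (x (- alpha i))) v0 = 0)
  (lam_ge0 : forall i, 0 <= heval lam (h i)).

Let op y (a : K) v := a *: act y v.

Let aV : current_action op.
Proof.
split=> [a v k y z|y a k u v|y z a b v]; rewrite /op.
- by rewrite (repDl rV) (repZl rV) scalerDr !scalerA mulrC.
- by rewrite (repDr rV) (repZr rV) scalerDr !scalerA mulrC.
- by rewrite (rep_lie rV) !(repZr rV) scalerBr !scalerA [b * a]mulrC.
Qed.

Let op1 mu u : hweight act mu u <-> hweight (fun y => op y 1) mu u.
Proof. by split=> hu t; move: (hu t); rewrite /op scale1r. Qed.

Lemma generated_lower u : generated u -> lower_span rts alpha x op v0 u.
Proof.
have op_pos b a : b \in pos -> op (x b) a v0 = 0.
  by move=> b_pos; rewrite /op v0_pos // scaler0.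
elim=> {u} [|k u v _ hu _ hv|y u _ hu]; first exact: lower_gen.
  exact: lower_lin.
by rewrite -[act y u]scale1r; exact: (lower_span_op RD aV op_pos y 1 hu).
Qed.

Let sum1 (X : hdual H -> Prop) u : weight_sum (fun y => op y 1) X u -> weight_sum act X u.
Proof.
by case=> s Xs us; exists s => // p /Xs[Xp /op1].
Qed.

Lemma generated_weights u : generated u ->
  weight_sum act (fun mu => weight_le alpha mu lam) u.
Proof.
move=> /generated_lower hu; apply: sum1.
by apply: (lower_span_weights RD aV _ hu); apply/op1.
Qed.

Lemma generated_top u : generated u -> hweight act lam u ->
  exists c, u = c *: v0.
Proof.
move=> /generated_lower hu hlam.
have v0_cartan t a : exists c, op (vsval t) a v0 = c *: v0.
  by exists (a * heval lam t); rewrite /op v0_weight scalerA.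
have [c /sum1 hc] := lower_span_top RD aV (iffLR (op1 _ _) v0_weight) v0_cartan hu.
exists c; apply/eqP; rewrite -subr_eq0; apply/negPn/negP => neq0.
have top : hweight act lam (u - c *: v0).
  by apply: (hweightD rV) => //; rewrite -scaleNr; exact: hweightZ.
by have [_ /eqP] := weight_sum_weight rV neq0 top hc.
Qed.

Lemma generated_nilpotent i u : generated u ->
  exists q, iter q (act (x (- alpha i))) u = 0.
Proof.
have aN := root_oppr RD (simple_root_mem RD i).
have iter_lin N a v w : iter N (act (x (- alpha i))) (a *: v + w) =
    a *: iter N (act (x (- alpha i))) v + iter N (act (x (- alpha i))) w.
  by elim: N => //= N ->; rewrite (rep_linr rV).
have iter0 N : iter N (act (x (- alpha i))) 0 = 0.
  by elim: N => //= N ->; rewrite (rep0r rV).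
elim=> {u} [|k u v _ [N hu] _ [M hv]|y u _ hu]; first exact: v0_nil.
  exists (N + M)%N.
  by rewrite iter_lin addnC iterD hu iter0 scaler0 add0r addnC iterD hv iter0.
apply: (nilpotent_act rV) => //.
exact: (ad_root_nilpotent RD aN (rd_root_vector RD aN)).
Qed.

Let cas := casimir (dual_pairs rts alpha omega x h) act.

Lemma generated_casimir u : generated u ->
  cas u = casimir_value rts alpha omega x h co lam *: u.
Proof.
have casC := casimir_comm (rd_basis RD) (dual_pairs_left RD) (dual_pairs_right RD) rV.
elim=> {u} [|k u v _ hu _ hv|y u _ hu].
- exact: (casimir_highest RD).
- rewrite -[cas _]/(casimir _ _ _) /casimir.
  under eq_bigr do rewrite !(rep_linr rV).
  rewrite big_split -scaler_sumr -/(casimir _ _ u) -/(casimir _ _ v) /=.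
  rewrite -!/(cas _) hu hv scalerDr !scalerA; congr (_ *: _ + _).
  by rewrite mulrC.
- by rewrite /cas casC -/(cas u) hu (repZr rV).
Qed.

(** The Casimir operator acts on u by its value at lam, because u is in the module
    generated by v0, and by its value at mu, because u is a highest weight
    vector; both weights are dominant. *)
Lemma generated_highest_weight mu u : generated u -> u != 0 ->
  hweight act mu u -> (forall b, b \in pos -> act (x b) u = 0) -> mu = lam.
Proof.
move=> gu u0 hu u_pos.
have mu_ge0 i : 0 <= heval mu (h i).
  have ai_rt := simple_root_mem RD i; have [ef hf he] := coroot_sl2 RD ai_rt.
  have [k [-> _]] := sl2_dominant rV ef hf u0 (u_pos _ (simple_root_positive RD i))
    (etrans (hu _) (congr1 (fun t => heval mu t *: u) (esym (rd_simple_coroot RD i))))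
    (generated_nilpotent i gu).
  exact: ler0n.
apply/esym; apply: (casimir_value_inj RD lam_ge0 mu_ge0).
  exact: (weight_sum_weight rV u0 hu (generated_weights gu)).
apply/eqP; rewrite -subr_eq0.
have : (casimir_value rts alpha omega x h co lam -
        casimir_value rts alpha omega x h co mu) *: u == 0.
  by rewrite scalerBl -generated_casimir // -(casimir_highest RD rV hu u_pos) subrr.
by rewrite scaler_eq0 (negPf u0) orbF.
Qed.

(** Among the nonzero weight vectors of N, one of weight mu with lam - mu of least
    height is killed by n^+, so it has weight lam and is a multiple of v0. *)
Theorem integrable_simple (N : V -> Prop) :
    (forall a u v, N u -> N v -> N (a *: u + v)) ->
    (forall y u, N u -> N (act y u)) -> (forall u, N u -> generated u) ->
    forall u, N u -> u != 0 -> N v0.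
Proof.
move=> Nlin Nact Ngen u Nu u0.
have N0 : N 0 by rewrite -(addNr u) -scaleN1r; exact: Nlin.
have [mu mu_lam [w [Nw w0 hw]]] := weight_sum_component rV Nlin
  (fun t v => Nact (vsval t) v) Nu u0 (generated_weights (Ngen _ Nu)).
have [k hk] := height_nat mu_lam.
elim/ltn_ind: k mu mu_lam w Nw w0 hw hk => k IHk mu mu_lam w Nw w0 hw hk.
have [[b b_pos /eqP bw]|no_b] := pselect (exists2 b, b \in pos & act (x b) w <> 0).
  have /positive_rootP[b_rt _] := b_pos.
  have hbw := hweight_root rV (rd_root_vector RD b_rt) hw.
  have bmu_lam := weight_sum_weight rV bw hbw (generated_weights (Ngen _ (Nact _ _ Nw))).
  have [l hl] := height_nat bmu_lam; have [d hd] := height_root b_pos.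
  (* lam - (b + mu) is smaller in height than lam - mu by the height of b. *)
  apply: (IHk l _ _ bmu_lam _ (Nact _ _ Nw) bw hbw hl).
  have : k%:R = l%:R + d.+1%:R :> K.
    by rewrite -hk -hl -hd /height -hevalD opprD addrA addrAC subrK.
  by rewrite -natrD => /eqP; rewrite eqr_nat => /eqP ->; rewrite addnS ltnS leq_addr.
have w_pos b : b \in pos -> act (x b) w = 0.
  by move=> b_pos; apply: contrapT => bw; apply: no_b; exists b.
have mu_eq := generated_highest_weight (Ngen _ Nw) w0 hw w_pos.
rewrite mu_eq in hw; have [c wc] := generated_top (Ngen _ Nw) hw.
have c0 : c != 0 by apply: contraNneq w0 => c0; rewrite wc c0 scale0r.
have -> : v0 = c^-1 *: w + 0 by rewrite addr0 wc scalerA mulVf // scale1r.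
exact: Nlin.
Qed.

End Integrable.

(** * Maps out of a simple highest weight module *)
Section FiniteDimensional.
Variables (K : numFieldType) (g : finLieType K) (H : {vspace g}).
Variables (V : lmodType K) (act : g -> V -> V).
Hypothesis rV : lie_rep act.

(** More vectors y^q v than the dimension allows satisfy a linear relation, while
    they have pairwise distinct weights. *)
Lemma findim_nilpotent (s : seq V) (mu nu : hdual H) y v :
    (forall w, exists c : 'I_(size s) -> K, w = \sum_i c i *: s`_i) ->
    nu != 0 -> root_space nu y -> hweight act mu v ->
  exists q, iter q (act y) v = 0.
Proof.
move=> s_span nu0 hy hv; apply: contrapT => /forallNP nz.
have hiter q : hweight act (nu *+ q + mu) (iter q (act y) v).
  elim: q => [|q IHq]; first by rewrite add0r.
  by rewrite mulrS -addrA; exact: (hweight_root rV).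
have [c hc] := choice (fun q => s_span (iter q (act y) v)).
pose C : 'M[K]_((size s).+1, size s) := \matrix_(q, i) c q i.
(* Row q of C holds the coordinates of y^q v: one row more than columns. *)
have /rowV0Pn[r /sub_kermxP rC r0] : kermx C != 0.
  rewrite kermx_eq0 /row_free neq_ltn ltnS.
  by rewrite (leq_trans (rank_leq_col C)).
have rel : \sum_q r 0 q *: iter q (act y) v = 0.
  under eq_bigr => q _ do rewrite (hc q) scaler_sumr.
  rewrite exchange_big big1 // => i _ /=.
  under eq_bigr => q _ do rewrite scalerA.
  rewrite -scaler_suml; have /rowP/(_ i) := rC; rewrite !mxE => rCi.
  by rewrite (eq_bigr (fun q => r 0 q * C q i)) ?rCi ?scale0r // => q _; rewrite mxE.
have [q0 rq0] : exists q0, r 0 q0 != 0.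
  by move: r0 => /rV0Pn.
have inj (q q' : nat) : nu *+ q + mu = nu *+ q' + mu -> q = q'.
  move=> /addIr /eqP; rewrite -!scaler_nat -subr_eq0 -scalerBl scaler_eq0.
  by rewrite (negPf nu0) orbF subr_eq0 eqr_nat => /eqP.
pose X w := exists2 q : nat, w = nu *+ q + mu & q != q0.
have neq : r 0 q0 *: iter q0 (act y) v != 0.
  by rewrite scaler_eq0 negb_or rq0; apply/eqP/nz.
have hX : weight_sum act X (r 0 q0 *: iter q0 (act y) v).
  move: rel; rewrite (bigD1 q0) //= => /eqP; rewrite addr_eq0 => /eqP ->.
  rewrite -scaleN1r; apply: (weight_sumZ rV).
  elim/big_ind: _ => [|u w|q qq0]; [exact: weight_sum0|exact: weight_sumD|].
  apply: (@weight_sum_gen _ _ _ _ _ _ (nu *+ q + mu)); first by exists q.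
  exact: (hweightZ rV).
have [q /inj <- /eqP//] := weight_sum_weight rV neq (hweightZ rV _ (hiter q0)) hX.
Qed.

End FiniteDimensional.

Section HighestWeightLift.
Variables (K : numFieldType) (g : finLieType K) (H : {vspace g}) (n : nat).
Variables (rts : seq (hdual H)) (alpha omega : 'I_n -> hdual H).
Variables (x : hdual H -> g) (h : 'I_n -> subvs_of H) (co : hdual H -> subvs_of H).
Hypothesis RD : root_datum rts alpha omega x h co.
Local Notation pos := (positive_roots rts alpha).

Record integrable_vector (lam : hdual H) (V : lmodType K) (act : g -> V -> V)
    (v : V) : Prop := IntegrableVector {
  iv_weight : hweight act lam v;
  iv_pos : forall b, b \in pos -> act (x b) v = 0;
  iv_nil : forall i, exists q, iter q (act (x (- alpha i))) v = 0
}.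

Variables (V M : lmodType K) (actV : g -> V -> V) (actM : g -> M -> M).
Hypotheses (rV : lie_rep actV) (rM : lie_rep actM).
Variables (lam : hdual H) (v : V) (m : M).
Hypotheses (lam_ge0 : forall i, 0 <= heval lam (h i)).
Hypotheses (hv : integrable_vector lam actV v) (hm : integrable_vector lam actM m).
Hypotheses (v0 : v != 0) (v_gen : forall w, generated actV v w).

Let act y (p : V * M) : V * M := (actV y p.1, actM y p.2).

Let rVM : lie_rep act.
Proof.
split=> [[w p] a y z|y a [w p] [w' p']|y z [w p]].
- by rewrite /act /= (rep_linl rV) (rep_linl rM).
- by rewrite /act /= (rep_linr rV) (rep_linr rM).
- by rewrite /act /= (rep_lie rV) (rep_lie rM).
Qed.

Let iter_act q y w p : iter q (act y) (w, p) = (iter q (actV y) w, iter q (actM y) p).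
Proof. by elim: q => //= q ->. Qed.

Let iter0 (W : lmodType K) (actW : g -> W -> W) q y : lie_rep actW ->
  iter q (actW y) 0 = 0.
Proof. by move=> rW; elim: q => //= q ->; rewrite (rep0r rW). Qed.

Local Notation graph := (generated act (v, m)).

(** A pair (0, p - p') that is not zero would generate, by simplicity, a module
    containing (v, m); but all its elements have first component 0, and v is
    not 0. *)
Lemma graph_functional w p p' : graph (w, p) -> graph (w, p') -> p = p'.
Proof.
move=> gp gp'; apply/eqP; rewrite -subr_eq0; apply/negPn/negP => neq.
have graphZD a u u' : graph u -> graph u' -> graph (a *: u + u') by exact: gen_lin.
have vm_weight : hweight act lam (v, m).
  by move=> t; rewrite /act /= (iv_weight hv) (iv_weight hm).
have vm_pos b : b \in pos -> act (x b) (v, m) = 0.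
  by move=> b_pos; rewrite /act /= (iv_pos hv) // (iv_pos hm).
have vm_nil i : exists q, iter q (act (x (- alpha i))) (v, m) = 0.
  have [[q hq] [r hr]] := (iv_nil hv i, iv_nil hm i); exists (q + r)%N.
  rewrite iter_act {1}addnC !iterD hq hr !iter0 //.
pose N u := graph u /\ u.1 = 0.
have Nlin a u u' : N u -> N u' -> N (a *: u + u').
  move=> [gu u0] [gu' u'0]; split; first exact: gen_lin.
  by rewrite /= u0 u'0 scaler0 addr0.
have Nact y u : N u -> N (act y u).
  by move=> [gu u0]; split; [exact: gen_act | rewrite /= u0 (rep0r rV)].
have Nu : N (0, p - p').
  split=> //; have := gen_lin (-1) gp' gp.
  by rewrite [_ + _](_ : _ = (0, p - p')) //; congr (_, _); rewrite /= scaleN1r addrC ?subrr.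
have [] := integrable_simple RD rVM vm_weight vm_pos vm_nil lam_ge0 Nlin Nact _ Nu.
- by move=> u [].
- by apply: contra neq => /eqP[->].
by move=> _ /eqP; rewrite (negPf v0).
Qed.

Theorem highest_weight_lift :
  exists phi : V -> M, [/\ linear phi,
    forall y w, phi (actV y w) = actM y (phi w) & phi v = m].
Proof.
have /choice[phi hphi] w : exists p, graph (w, p).
  elim: (v_gen w) => {w} [|k u u' _ [p hp] _ [p' hp']|y u _ [p hp]].
  - by exists m; exact: gen_self.
  - by exists (k *: p + p'); exact: (gen_lin k hp hp').
  - by exists (actM y p); exact: (gen_act y hp).
exists phi; split=> [k u u'|y w|].
- exact: graph_functional (hphi _) (gen_lin k (hphi u) (hphi u')).
- exact: graph_functional (hphi _) (gen_act y (hphi w)).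
- exact: graph_functional (hphi _) (gen_self _ _).
Qed.

End HighestWeightLift.

(** * Modules over enveloping algebras *)

Section Restriction.
Variables (K : fieldType) (U : algType K) (M : lmodType U).

(** A module over a K-algebra U has no K-module structure of its own here; this
    alias of M carries the one obtained through a |-> a 1. *)
Definition rscal : Type := M.
HB.instance Definition _ := GRing.Zmodule.on rscal.

Definition rscale (a : K) (m : rscal) : rscal := (a%:A : U) *: (m : M).

Lemma rscaleA a b m : rscale a (rscale b m) = rscale (a * b) m.
Proof. by rewrite /rscale scalerA mulr_algl scalerA. Qed.

Lemma rscale1 : left_id 1 rscale.
Proof. by move=> m; rewrite /rscale !scale1r. Qed.

Lemma rscaleDr : right_distributive rscale +%R.
Proof. by move=> a m m'; exact: scalerDr. Qed.

Lemma rscaleDl m : {morph rscale^~ m : a b / a + b}.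
Proof. by move=> a b; rewrite /rscale scalerDl [LHS]scalerDl. Qed.

HB.instance Definition _ := GRing.Zmodule_isLmodule.Build K rscal
  rscaleA rscale1 rscaleDr rscaleDl.

Lemma rscalE a (m : rscal) : a *: m = (a%:A : U) *: (m : M) :> M.
Proof. by []. Qed.

Lemma rscal_linearr (u : U) : linear (fun m : rscal => (u *: (m : M) : rscal)).
Proof.
by move=> a m m'; rewrite scalerDr; congr (_ + _);
   rewrite !rscalE !scalerA mulr_algl mulr_algr.
Qed.

Lemma rscal_linearl (m : rscal) : linear (fun u : U => (u *: (m : M) : rscal)).
Proof. by move=> a u u'; rewrite scalerDl; congr (_ + _); rewrite -mulr_algl -scalerA. Qed.

End Restriction.

Section EnvelopingModules.
Variables (K : fieldType) (g : lieType K).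

Lemma ugen_rep (V : lmodType (uenv g)) :
  lie_rep (fun y (w : rscal V) => ugen y *: (w : V) : rscal V).
Proof.
split=> [w a y z|y|y z w].
- by rewrite linearP; exact: (@rscal_linearl _ _ V w).
- exact: (@rscal_linearr _ _ V).
- by rewrite ugen_lie scalerBl !scalerA.
Qed.

Variable A : comAlgType K.
Local Notation UA := (uenv (current g A)).

Lemma ucurrent_action (M : lmodType UA) :
  current_action (fun y (a : A) (m : rscal M) => ugen (cpure y a) *: (m : M) : rscal M).
Proof.
split=> [a m k y z|y a|y z a b m].
- by rewrite /cpure tpureDl tpureZl linearP; exact: (@rscal_linearl _ _ M m).
- exact: (@rscal_linearr _ _ M).
- by rewrite -[cpure (lie y z) _]clieE [ugen _]ugen_lie scalerBl !scalerA.
Qed.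

Lemma uinc_ugen (y : g) : uinc A (ugen y) = gen1 A y.
Proof. exact: (uenv_lift_gen (@gen1_is_linear K g A) (@gen1_lie K g A)). Qed.

Lemma uincC a : uinc A (a%:A : uenv g) = a%:A.
Proof. exact: (uenv_liftC (@gen1_is_linear K g A) (@gen1_lie K g A)). Qed.

End EnvelopingModules.

(** * The presentation of the Weyl module *)
Section WeylModule.
Variables (K : numFieldType) (g : finLieType K) (H : {vspace g}) (n : nat).
Variables (rts : seq (hdual H)) (alpha omega : 'I_n -> hdual H).
Variables (x : hdual H -> g) (h : 'I_n -> subvs_of H) (co : hdual H -> subvs_of H).
Hypothesis RD : root_datum rts alpha omega x h co.
Local Notation pos := (positive_roots rts alpha).
Variables (A : comAlgType K) (lam : hdual H) (V : lmodType (uenv g)) (v : V).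
Local Notation UA := (uenv (current g A)).
Hypotheses (lam_dominant : nat_span omega lam)
  (V_findim : findim_module V) (V_irreducible : irreducible_module V)
  (v_highest : highest_weight_vector rts alpha x lam v).

Local Notation actV := (fun y (w : rscal V) => ugen y *: (w : V) : rscal V).
Local Notation weyl_rel := (weyl_relation rts alpha x h (A := A) lam).

Lemma dominant_nat i : exists k : nat, heval lam (h i) = k%:R.
Proof.
case: lam_dominant => c ->; exists (c i); rewrite heval_sum (bigD1 i) //= hevalMn.
rewrite (rd_fundamental RD) eqxx big1 ?addr0 // => j /negPf ji.
by rewrite hevalMn (rd_fundamental RD) ji mul0rn.
Qed.

Lemma nplus_pos b : b \in pos -> x b \in nplus rts alpha x.
Proof. by move=> b_pos; rewrite memv_span // map_f. Qed.

(** Finite dimension makes x^-_i nilpotent on v, and then sl2 theory gives the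
    exact exponent. *)
Lemma highest_weight_power i k : heval lam (h i) = k%:R ->
  iter k.+1 (actV (x (- alpha i))) v = 0.
Proof.
case: v_highest => v0 hv v_pos hk; have rV := ugen_rep V.
have ai_rt := simple_root_mem RD i; have [ef hf he] := coroot_sl2 RD ai_rt.
have aN_rt := root_oppr RD ai_rt.
have ev : actV (x (alpha i)) v = 0 by rewrite v_pos // nplus_pos // (simple_root_positive RD).
have hhv : actV (vsval (co (alpha i))) v = (k%:R : K) *: (v : rscal V).
  by rewrite -hk (rd_simple_coroot RD) hv.
case: V_findim => s s_span.
have f_nil := findim_nilpotent rV (s := (s : seq (rscal V))) s_span
  (root_neq0 RD aN_rt) (rd_root_vector RD aN_rt) (hv : hweight actV lam v).
have [l [/eqP kl fl]] := sl2_dominant rV ef hf v0 ev hhv f_nil.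
by move: kl; rewrite eqr_nat => /eqP ->.
Qed.

Lemma irreducible_generated (w : V) : generated actV v w.
Proof.
have rV := ugen_rep V.
case: v_highest => v0 _ _; case: V_irreducible => _ irr.
have gen0 : generated actV v 0.
  by rewrite -(addNr (v : rscal V)) -scaleN1r; apply: gen_lin; exact: gen_self.
have genD (a b : rscal V) : generated actV v a -> generated actV v b -> generated actV v (a + b).
  by rewrite -{2}[a]scale1r; exact: gen_lin.
have genU (u : uenv g) (m : V) : generated actV v m -> generated actV v (u *: m).
  elim/uenv_ind: u m => [a|y|p q IHp IHq|p q IHp IHq] m hm.
  - by have := gen_lin a hm gen0; rewrite addr0.
  - exact: gen_act.
  - by rewrite scalerDl; apply: genD; [exact: IHp|exact: IHq].
  - by rewrite -scalerA; apply: IHp; exact: IHq.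
have [||all0|] := irr (generated actV v); first exact: gen0.
- by move=> u m m' hm hm'; apply: genD => //; exact: genU.
- by rewrite (all0 v (gen_self _ _)) eqxx in v0.
- exact.
Qed.

(** The elements of U(g) cross the tensor sign. *)
Lemma PA_inc (u : uenv g) (w : V) :
  uinc A u *: (ext_pure (@uinc K g A) 1 w : PA A V) = ext_pure (@uinc K g A) 1 (u *: w).
Proof.
rewrite [LHS]ext_scale_pure mulr1 -[uinc A u]mul1r.
exact: bpure_balanced.
Qed.

Local Notation p := (p_ A v).
Local Notation w := (w_ alpha A lam v).

Lemma PA_generated (q : PA A V) : exists u : UA, q = u *: p.
Proof.
have V_gen (w' : V) : exists u : uenv g, w' = u *: v.
  elim: (irreducible_generated w') => {w'} [|k w1 w2 _ [u1 ->] _ [u2 ->]|y w1 _ [u1 ->]].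
  - by exists 1; rewrite scale1r.
  - by exists (k%:A * u1 + u2); rewrite scalerDl -scalerA.
  - by exists (ugen y * u1); rewrite -scalerA.
elim/btens_ind: q => [u w'||q [u ->]|q1 q2 [u1 ->] [u2 ->]].
- have [u' ->] := V_gen w'; exists (u * uinc A u').
  rewrite -scalerA PA_inc [RHS]ext_scale_pure mulr1 //.
- by exists 0; rewrite scale0r.
- by exists (- u); rewrite scaleNr.
- by exists (u1 + u2); rewrite scalerDl.
Qed.

Lemma p_weight : weight_space (@gen1 K g A) lam p.
Proof.
case: v_highest => _ hv _ t.
by rewrite -uinc_ugen PA_inc hv -PA_inc uincC.
Qed.

Lemma w_scale (u : UA) :
  u *: w = modq_pi (@bad_weight_vector _ _ _ _ alpha _ lam (PA A V)) (u *: p).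
Proof. by rewrite linearZ. Qed.

(** A positive root vector moves p to a weight lam + b, which the truncation kills;
    the other two kinds of relations already hold for p itself. *)
Lemma weyl_relation_w u : weyl_rel u -> u *: w = 0.
Proof.
case: v_highest => v0 hv v_pos.
have aP := ucurrent_action (PA A V).
case=> [y a|t|i k hk].
- pose F z : rscal (WA alpha A lam V) := ugen (cpure z a) *: w.
  have Flin : linear F := act_linl (ucurrent_action _) a w.
  have F0 : F 0 = 0 by have := Flin (-1) 0 0; rewrite scaler0 addr0 scaleN1r addNr.
  have FD z z' : F (z + z') = F z + F z' by rewrite -[z]scale1r Flin !scale1r.
  move=> y_pos; change (F y = 0); rewrite (coord_span (X := in_tuple _) y_pos).
  rewrite (big_morph F FD F0) big1 // => l _.
  rewrite -[_ *: _]addr0 Flin F0 addr0.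
  set z := _`_l; suff -> : F z = 0 by rewrite scaler0.
  have /mapP[b b_pos ->] : z \in [seq x mu | mu <- pos] by apply: mem_nth.
  rewrite /F w_scale -(linear0 (modq_pi _)).
  apply/modq_piP; rewrite subr0; apply: span_of_gen; exists (b + lam).
    have /negP := positive_rootN RD b_pos; apply: contra_not.
    rewrite /weight_le opprD addrCA subrr addr0 => bN; apply/positive_rootP; split=> //.
    by apply: (root_oppr RD); case/positive_rootP: b_pos.
  have /positive_rootP[b_rt _] := b_pos.
  exact: (op_hweight aP a (rd_root_vector RD b_rt) p_weight).
- by rewrite w_scale scalerBl p_weight subrr linear0.
- rewrite w_scale -uinc_ugen -rmorphXn PA_inc.
  have -> : ugen (x (- alpha i)) ^+ k.+1 *: v = 0.
    rewrite -(highest_weight_power hk); elim: {hk}k.+1 => [|q IHq]; first by rewrite scale1r.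
    by rewrite exprS -scalerA IHq.
  suff -> : ext_pure (uinc A) 1 (0 : V) = 0 :> PA A V by rewrite linear0.
  apply: (addrI (ext_pure (uinc A) 1 0 : PA A V)).
  by rewrite addr0 -[LHS]bpureDr addr0.
Qed.


Definition weyl_quotient : lmodType UA := modq (weyl_rel : UA^o -> Prop).
Definition weyl_generator : weyl_quotient := modq_pi _ (1 : UA^o).

Local Notation M := weyl_quotient.
Local Notation m := weyl_generator.
Local Notation opM := (fun y (a : A) (u : rscal M) => ugen (cpure y a) *: (u : M) : rscal M).

Lemma weyl_generator_scale (u : UA) : u *: m = 0 <-> span_of (weyl_rel : UA^o -> Prop) u.
Proof.
have -> : u *: m = modq_pi _ (u : UA^o).
  by rewrite /m -linearZ /= [_ *: _]mulr1.
by rewrite -(linear0 (modq_pi _)) modq_piP subr0.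
Qed.

Lemma weyl_generator_rel u : weyl_rel u -> u *: m = 0.
Proof. by move=> hu; apply/weyl_generator_scale/span_of_gen. Qed.

Lemma weyl_generator_weight : hweight (fun y => opM y 1) lam m.
Proof.
move=> t.
have /weyl_generator_rel/eqP := weyl_cartan rts alpha x h A lam t.
by rewrite scalerBl subr_eq0 => /eqP.
Qed.

Lemma weyl_generator_pos b a : b \in pos -> opM (x b) a m = 0.
Proof. by move=> b_pos; apply/weyl_generator_rel/weyl_nplus/nplus_pos. Qed.

(** m generates its module, so [lower_span] is everything; this is the point at
    which n^+ (x) A, and not only n^+, has to kill m. *)
Lemma weyl_quotient_weights (u : M) :
  weight_sum (fun y => opM y 1) (fun mu => weight_le alpha mu lam) u.
Proof.
have aM := ucurrent_action M.
apply: (lower_span_weights RD aM weyl_generator_weight).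
have lD (u1 u2 : rscal M) : lower_span rts alpha x opM m u1 ->
    lower_span rts alpha x opM m u2 -> lower_span rts alpha x opM m (u1 + u2).
  exact: lower_spanD.
have scaleS (z : UA) (u' : M) :
    lower_span rts alpha x opM m u' -> lower_span rts alpha x opM m (z *: u').
  elim/uenv_ind: z u' => [a|y|z1 z2 IH1 IH2|z1 z2 IH1 IH2] u' hu'.
  - exact: (lower_spanZ a hu').
  - elim/tens_ind: y => [y a|y1 y2 IH1 IH2].
      exact: (lower_span_op RD aM weyl_generator_pos y a hu').
    by rewrite linearD scalerDl; exact: lD.
  - by rewrite scalerDl; apply: lD; [exact: IH1 | exact: IH2].
  - by rewrite -scalerA; apply: IH1; exact: IH2.
elim/modq_ind: u => u.
have -> : modq_pi _ u = (u : UA) *: m by rewrite /m -linearZ /= [_ *: _]mulr1.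
by apply: scaleS; exact: lower_gen.
Qed.

(** The map is b (x) w' |-> b phi(w'), where phi : V -> M is the g-map given by
    [highest_weight_lift]. *)
Lemma weyl_quotient_lift : exists Phi : PA A V -> M,
  [/\ {morph Phi : q r / q + r}, forall (u : UA) q, Phi (u *: q) = u *: Phi q
    & Phi p = m].
Proof.
have [v0 hv v_pos] := v_highest.
have rM := lie_rep_current (ucurrent_action M).
have iv_v : integrable_vector rts alpha x lam actV v.
  split=> // [b b_pos|i]; first by rewrite v_pos // nplus_pos.
  by have [k /highest_weight_power hk] := dominant_nat i; exists k.+1.
have iv_m : integrable_vector rts alpha x lam (fun y => opM y 1) m.
  split=> [|b b_pos|i]; first exact: weyl_generator_weight.
    exact: weyl_generator_pos.
  have [k hk] := dominant_nat i; exists k.+1.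
  rewrite -[RHS](weyl_generator_rel (weyl_power rts alpha x A hk)).
  elim: {hk}k.+1 => [|q IHq]; first by rewrite scale1r.
  by rewrite exprS -scalerA -IHq.
have lam_ge0 i : 0 <= heval lam (h i) by have [k ->] := dominant_nat i.
have [phi [phi_lin phi_act phi_v]] :=
  highest_weight_lift RD (ugen_rep V) rM lam_ge0 iv_v iv_m v0 irreducible_generated.
have phiD : {morph phi : w1 w2 / w1 + w2}.
  by move=> w1 w2; rewrite -[w1]scale1r phi_lin !scale1r.
have phi0 : phi 0 = 0 by apply: (addrI (phi 0)); rewrite -phiD !addr0.
have phi_inc (u : uenv g) (w' : V) : phi (u *: w') = uinc A u *: (phi w' : M).
  elim/uenv_ind: u w' => [a|y|u1 u2 IH1 IH2|u1 u2 IH1 IH2] w'.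
  - by rewrite uincC; have := phi_lin a w' 0; rewrite phi0 !addr0.
  - by rewrite uinc_ugen; exact: phi_act.
  - by rewrite scalerDl phiD IH1 IH2 rmorphD scalerDl.
  - by rewrite -scalerA IH1 IH2 rmorphM scalerA.
pose f (b : UA) (w' : V) : M := b *: (phi w' : M).
have fDl b b' w' : f (b + b') w' = f b w' + f b' w' by rewrite /f scalerDl.
have fDr b w1 w2 : f b (w1 + w2) = f b w1 + f b w2 by rewrite /f phiD scalerDr.
have f_bal b u w' : f (b * uinc A u) w' = f b (u *: w') by rewrite /f phi_inc scalerA.
pose Phi : PA A V -> M := btens_lift f.
have PhiD : {morph Phi : q r / q + r} by move=> q r; exact: btens_liftD.
have Phi0 : Phi 0 = 0 by apply: (addrI (Phi 0)); rewrite -PhiD !addr0.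
have PhiN q : Phi (- q) = - Phi q by apply/eqP; rewrite -addr_eq0 -PhiD addNr Phi0.
have Phi_pure b w' : Phi (ext_pure (uinc A) b w') = b *: (phi w' : M).
  exact: btens_lift_pure.
exists Phi; split=> //; last by rewrite Phi_pure phi_v scale1r.
move=> u; elim/btens_ind=> [b w'||q IHq|q r IHq IHr].
- by rewrite [u *: _]ext_scale_pure !Phi_pure scalerA.
- by rewrite scaler0 Phi0 scaler0.
- by rewrite scalerN !PhiN IHq scalerN.
- by rewrite scalerDr !PhiD IHq IHr scalerDr.
Qed.

(** If u w = 0 then u p is a combination of vectors whose weights are not below
    lam; their images in M are vectors of the same weights, hence zero, so
    u m = 0. *)
Theorem weyl_module_presented : presented_by w weyl_rel.
Proof.
split=> [w'|u].
  elim/modq_ind: w' => q; have [u ->] := PA_generated q.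
  by exists u; rewrite w_scale.
split=> [|[s s_rel ->]]; last first.
  rewrite scaler_suml big1_seq // => q /andP[_ /s_rel hq].
  by rewrite -scalerA weyl_relation_w // scaler0.
rewrite w_scale -(linear0 (modq_pi _)) => /modq_piP; rewrite subr0 => -[s s_bad us].
have [Phi [PhiD PhiZ Phip]] := weyl_quotient_lift.
have Phi0 : Phi 0 = 0 by apply: (addrI (Phi 0)); rewrite -PhiD !addr0.
apply/weyl_generator_scale; rewrite -Phip -PhiZ us (big_morph Phi PhiD Phi0).
rewrite big1_seq // => q /andP[_ /s_bad[mu mu_lam hq]]; rewrite PhiZ.
suff -> : Phi q.2 = 0 by rewrite scaler0.
apply: contrapT => /eqP Phi_neq0; apply: mu_lam.
apply: (weight_sum_weight (lie_rep_current (ucurrent_action M)) Phi_neq0 _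
  (weyl_quotient_weights _)).
by move=> t; have := congr1 Phi (hq t); rewrite !PhiZ.
Qed.

End WeylModule.

Unset Implicit Arguments.
Local Open Scope complex_scope.

Theorem proposition3p3 (R : realType) (g : finLieType R[i])
    (H : {vspace g}) (n : nat) (rts : seq (hdual H))
    (alpha omega : 'I_n -> hdual H) (x : hdual H -> g) (h : 'I_n -> subvs_of H)
    (A : comAlgType R[i]) (lam : hdual H) (V : lmodType (uenv g)) (v : V)
    (g_simple : simple_lie g) (H_cartan : cartan_subalgebra H)
    (g_rank : \dim H = n)
    (rts_roots : root_system rts) (alpha_simple : simple_roots rts alpha)
    (x_h_chevalley : chevalley_basis rts alpha x h)
    (omega_fundamental : fundamental_weights h omega)
    (lam_dominant : nat_span omega lam)
    (V_findim : findim_module V) (V_irreducible : irreducible_module V)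
    (v_highest : highest_weight_vector rts alpha x lam v) :
  presented_by (w_ alpha A lam v) (weyl_relation rts alpha x h (A := A) lam).
Proof.
have [x_root x_basis [co [co_spec h_co]] x_bracket] := x_h_chevalley.
have RD : root_datum rts alpha omega x h co.
  split=> // [mu /co_spec[]|mu /co_spec[]|mu nu mu_rt nu_rt mn_rt] //.
  by have [c] := x_bracket mu nu mu_rt nu_rt mn_rt; exists c.
exact (weyl_module_presented RD A lam_dominant V_findim V_irreducible v_highest).
Qed.
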